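(* Let $d\ge1$. Consider a stationary sequence of $\mathbb{R}^d$-valued random variables $(X_n)_{n\ge 1}$ with common law $\mu$ and set $\mu_N:=N^{-1}\sum_{i=1}^N \delta_{X_i}$. Assume that this sequence is $\rho$-mixing, for some $\rho:\mathbb{N}\to\mathbb{R}^+$ satisfying $\sum_{n\geq 0} \rho_n<\infty$. Let $p>0$ and assume that $M_q(\mu)<\infty$ for some $q>p$. Then there exists a constant $C$ depending only on $p,d,q, M_q(\mu),\rho$ such that, for all $N\geq 1$, $$ \mathbb{E}\left(\mathcal{T}_p(\mu_N,\mu)\right) \leq C\left\{\begin{array}{ll} N^{-1/2} +N^{-(q-p)/q}& \text{if } p>d/2 \text{ and } q\ne 2p, \\ N^{-1/2} \log(1+N)+N^{-(q-p)/q} & \text{if } p=d/2 \text{ and } q\ne 2p, \\ N^{-p/d}+N^{-(q-p)/q} & \text{if } p\in (0,d/2) \text{ and } q\ne dp/(d-p). \end{array}\right. $$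
   Context: A stationary sequence $(X_n)_{n\ge 1}$ with common law $\mu$ is said to be $\rho$-mixing, for some $\rho:\mathbb{N}\to\mathbb{R}^+$ with $\rho_n\to 0$, if for all $f,g \in L^2(\mu)$ and all $i,j\geq 1$, $$\mathrm{Cov}(f(X_i),g(X_j))\le \rho_{|i-j|}\sqrt{\mathrm{Var}(f(X_i))\,\mathrm{Var}(g(X_j))}.$$ For $q>0$, $M_q(\mu):=\int_{\mathbb{R}^d}|x|^q\,\mu(dx)$, with $|\cdot|$ the Euclidean norm. For $p>0$ and probability measures $\mu,\nu$ on $\mathbb{R}^d$, $$\mathcal{T}_p(\mu,\nu)=\inf\left\{\int_{\mathbb{R}^d\times\mathbb{R}^d}|x-y|^p\,\xi(dx,dy)\;:\;\xi\in\mathcal{H}(\mu,\nu)\right\},$$ where $\mathcal{H}(\mu,\nu)$ is the set of all probability measures on $\mathbb{R}^d\times\mathbb{R}^d$ with marginals $\mu$ and $\nu$ (no $p$-th root is taken). *)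

(* Defs.v *)
(* Points of R^d are elements of [d.-tuple R], whose
   library sigma-algebra (generated by the coordinates) is the Borel one. *)
From HB Require Import structures.
From mathcomp Require Import all_boot all_order all_algebra.
From mathcomp Require Import all_classical all_reals all_analysis.

Set Implicit Arguments.
Unset Strict Implicit.
Unset Printing Implicit Defensive.

Import Order.TTheory GRing.Theory Num.Theory.
Import numFieldNormedType.Exports.

Local Open Scope classical_set_scope.
Local Open Scope ring_scope.

(* The library norm on vectors is the sup norm, hence these definitions. *)
Definition eucl_norm (R : realType) (d : nat) (x : d.-tuple R) : R :=
  Num.sqrt (\sum_(i < d) tnth x i ^+ 2).

Definition eucl_dist (R : realType) (d : nat) (x y : d.-tuple R) : R :=
  eucl_norm [tuple tnth x i - tnth y i | i < d].

Definition moment (R : realType) (d : nat) (q : R)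
    (mu : {measure set (d.-tuple R) -> \bar R}) : \bar R :=
  (\int[mu]_x (eucl_norm x `^ q)%:E)%E.

Definition couplings (R : realType) (dT : measure_display)
    (T : measurableType dT) (mu nu : {measure set T -> \bar R}) :
    set (probability (T * T)%type R) :=
  [set xi | forall A : set T, measurable A ->
     pushforward xi fst A = mu A /\ pushforward xi snd A = nu A].

(* Meant for probability measures; there is no p-th root. *)
Definition transport_cost (R : realType) (d : nat) (p : R)
    (mu nu : {measure set (d.-tuple R) -> \bar R}) : \bar R :=
  ereal_inf [set (\int[xi]_z (eucl_dist z.1 z.2 `^ p)%:E)%E
            | xi in couplings mu nu].

(* Sequences indexed by n >= 1 are indexed here from 0: the term [X i] stands
   for X_(i+1). *)

Definition has_law (R : realType) (dO dT : measure_display)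
    (Omega : measurableType dO) (T : measurableType dT)
    (P : probability Omega R) (X : {RV P >-> T}) (mu : probability T R) : Prop :=
  forall A : set T, measurable A -> distribution P X A = mu A.

(* Strict stationarity: all finite-dimensional laws are shift-invariant. *)
Definition stationary (R : realType) (dO dT : measure_display)
    (Omega : measurableType dO) (T : measurableType dT)
    (P : probability Omega R) (X : nat -> {RV P >-> T}) : Prop :=
  forall (n k : nat) (A : set (n.-tuple T)), measurable A ->
    pushforward P (fun w => [tuple X (k + i)%N w | i < n]) A =
    pushforward P (fun w => [tuple X i w | i < n]) A.

Definition rho_mixing (R : realType) (dO dT : measure_display)
    (Omega : measurableType dO) (T : measurableType dT)
    (P : probability Omega R) (mu : probability T R)
    (X : nat -> {RV P >-> T}) (rho : nat -> {nonneg R}) : Prop :=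
  ((rho n)%:num @[n --> \oo] --> (0 : R)) /\
  forall f g : T -> R, f \in Lfun mu 2%:E -> g \in Lfun mu 2%:E ->
  forall i j : nat,
    (covariance P (f \o X i) (g \o X j) <=
     (rho `|i%:Z - j%:Z|%N)%:num%:E *
       sqrte ('V_P[f \o X i] * 'V_P[g \o X j]))%E.

(* A probability measure as soon as N > 0 (and the null measure if N = 0). *)
Definition empirical_measure (R : realType) (dO dT : measure_display)
    (Omega : measurableType dO) (T : measurableType dT)
    (P : probability Omega R) (X : nat -> {RV P >-> T}) (N : nat) (w : Omega) :
    {measure set T -> \bar R} :=
  mscale ((N%:R^-1)%:nng : {nonneg R}) (msum (fun i => \d_(X i w)) N).

(* Main.v *)
Require Import Defs.
From HB Require Import structures.
From mathcomp Require Import all_boot all_order all_algebra ring lra.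
From mathcomp Require Import all_classical all_reals all_analysis measurable_realfun.

(** Why the rate holds.  The space is cut into the annuli where the norm has
order 2^k, for k up to some n, plus an unbounded outer region; each annulus
is cut again and again into dyadic cells, down to a depth that depends on k.
These nested finite partitions form a tree.  On a tree, an optimal coupling of
two mass distributions is easy to produce: match as much mass as possible
inside the finest cells, push the unmatched mass to the parent cells, and
start again ([tree_transport]).  The mass still unmatched after a cell has
been treated is exactly the discrepancy of the two masses of that cell, so the
transport cost is at most, up to a constant,

  sum over cells F of (diameter of the parent of F)^p * |mu_N F - mu F|

(with the radius of F in place of that diameter when F is an annulus) plus the
cost of moving mass inside the finest cells and in the outer region.
A coupling of cell masses lifts to a coupling of the measures themselves by
spreading each matched amount as a product of restrictions
([coupling_of_cell_coupling]), whence the deterministic estimate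
[transport_cost_le].

The randomness enters only through E|mu_N F - mu F|.  Applied to indicators,
rho-mixing with a summable rho bounds the variance of mu_N F by a constant
times mu F / N, as in the independent case ([mean_deviation_le]).  An annulus
of index k has 2^(l d) cells of level l, of total mass at most M 2^(-q k) by
the moment assumption.  Altogether E T_p is at most a constant times

  sum_(k <= n) (2^(p k - q k - p dep_k)
                + sum_(l <= dep_k) 2^(p (k - l)) 2^((l d - q k) / 2) N^(-1/2))
    + 2^(-n (q - p)),

where dep_k is the depth in the annulus k and the last term is the outer
region ([expected_transport_scale_sum]).  With 2^n of order N^(1/q), the last
term is of order N^(-(q-p)/q).  With 2^(d dep_k) of order N 2^(-q k), the
number of sample points expected in the annulus, the first term of the sum is
at most of the order of the second.  The remaining sums are geometric: in l
with ratio 2^(d/2 - p), which separates the three regimes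
([scale_sum_high], [scale_sum_critical], [scale_sum_low]), and then in k with
an exponent whose vanishing is precisely the excluded value of q.  If that
exponent is negative the innermost annulus dominates and gives the first term
of the rate; if it is positive the outermost one does, and since
N 2^(-q n) has order 1 it gives N^(-(q-p)/q). *)

Set Implicit Arguments.
Unset Strict Implicit.
Unset Printing Implicit Defensive.

Import Order.TTheory GRing.Theory Num.Theory.
Import numFieldNormedType.Exports.

Local Open Scope classical_set_scope.
Local Open Scope ring_scope.

(** * Transport between mass distributions on the leaves of a tree *)

(** Weighted tree distance between [i] and [j]: an edge of
weight [w l F] joins the cell [F] of level [l] to its parent, and the path from
[i] to [j] uses the two edges of level [l] exactly when their cells differ. *)
Definition tree_cost (R : realFieldType) (I : Type) (J : nat -> finType)
    (h : forall l, I -> J l) (w : forall l, J l -> R) (L : nat) (i j : I) : R :=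
  \sum_(l < L) (h l i != h l j)%:R * (w l (h l i) + w l (h l j)).

Definition cell_mass (R : realFieldType) (I J : finType) (h : I -> J)
    (m : I -> R) (F : J) : R := \sum_(i | h i == F) m i.

Lemma sum_cell_mass (R : realFieldType) (I J : finType) (h : I -> J)
    (v : J -> R) (m : I -> R) :
  \sum_i v (h i) * m i = \sum_F v F * cell_mass h m F.
Proof.
rewrite (partition_big h predT)//=; apply: eq_bigr => F _.
by rewrite mulr_sumr; apply: eq_bigr => i /eqP ->.
Qed.

(** One greedy step: inside a cell of masses [M] and [N], a product coupling
scaled by [min M N / (M N)] uses up the smaller of the two masses and takes
from each leaf a share proportional to its mass. *)
Lemma match_within_cells (R : realFieldType) (I J : finType) (h : I -> J)
    (m n : I -> R) :
  (forall i, 0 <= m i) -> (forall i, 0 <= n i) ->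
  exists g : I -> I -> R,
  [/\ forall i j, 0 <= g i j,
      forall i j, h i != h j -> g i j = 0,
      forall i, \sum_j g i j <= m i,
      forall j, \sum_i g i j <= n j
    & forall F, cell_mass h (fun i => \sum_j g i j) F
                  = Num.min (cell_mass h m F) (cell_mass h n F) /\
                cell_mass h (fun j => \sum_i g i j) F
                  = Num.min (cell_mass h m F) (cell_mass h n F)].
Proof.
move=> m0 n0.
pose M := cell_mass h m; pose N := cell_mass h n.
have M0 F : 0 <= M F by apply: sumr_ge0.
have N0 F : 0 <= N F by apply: sumr_ge0.
pose r F := Num.min (M F) (N F).
have r0 F : 0 <= r F by rewrite le_min M0 N0.
pose c F := r F / (M F * N F).
have c0 F : 0 <= c F by rewrite divr_ge0// mulr_ge0.
(* When M F or N F is 0 the quotient c F is 0, and so is r F. *)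
have cM F : c F * N F * M F = r F.
  rewrite /c /r; have [->|Mn] := eqVneq (M F) 0.
    by rewrite mulr0 (min_idPl (N0 F)).
  have [->|Nn] := eqVneq (N F) 0.
    by rewrite mulr0 mul0r (min_idPr (M0 F)).
  by field; rewrite Mn Nn.
have cN1 F : M F != 0 -> c F * N F <= 1.
  move=> Mn; have Mp : 0 < M F by rewrite lt_def Mn M0.
  by rewrite -(ler_pM2r Mp) cM mul1r ge_min lexx.
have cM1 F : N F != 0 -> c F * M F <= 1.
  move=> Nn; have Np : 0 < N F by rewrite lt_def Nn N0.
  by rewrite -(ler_pM2r Np) mulrAC cM mul1r ge_min lexx orbT.
have mM i : M (h i) = 0 -> m i = 0.
  by move/eqP; rewrite psumr_eq0// => /allP/(_ i); rewrite mem_index_enum eqxx => /(_ isT)/eqP.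
have nN i : N (h i) = 0 -> n i = 0.
  by move/eqP; rewrite psumr_eq0// => /allP/(_ i); rewrite mem_index_enum eqxx => /(_ isT)/eqP.
pose g i j := (h i == h j)%:R * (c (h i) * m i * n j).
have rowE i : \sum_j g i j = c (h i) * N (h i) * m i.
  rewrite /g [RHS]mulrAC /N /cell_mass [RHS]mulr_sumr [RHS]big_mkcond/=.
  by apply: eq_bigr => j _; rewrite eq_sym; case: eqP => _; rewrite ?mul1r ?mul0r.
have colE j : \sum_i g i j = c (h j) * M (h j) * n j.
  rewrite /g [RHS]mulrAC /M /cell_mass [RHS]mulr_sumr [RHS]big_mkcond/=; apply: eq_bigr => i _.
  case: eqP => [->|_]; rewrite ?mul1r ?mul0r//; ring.
exists g; split.
- by move=> i j; exact: mulr_ge0 (ler0n _ _) (mulr_ge0 (mulr_ge0 (c0 _) (m0 _)) (n0 _)).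
- by move=> i j /negbTE hij; rewrite /g hij mul0r.
- move=> i; rewrite rowE; have [/mM ->|Mn] := eqVneq (M (h i)) 0; first by rewrite mulr0.
  by rewrite ler_piMl// cN1.
- move=> i; rewrite colE; have [/nN ->|Nn] := eqVneq (N (h i)) 0; first by rewrite mulr0.
  by rewrite ler_piMl// cM1.
- move=> F; rewrite -/(r F) -cM; split; rewrite /cell_mass.
    rewrite /M /cell_mass [RHS]mulr_sumr; apply: eq_bigr => i /eqP <-; exact: rowE.
  rewrite [RHS]mulrAC /N /cell_mass [RHS]mulr_sumr; apply: eq_bigr => i /eqP <-; exact: colE.
Qed.

(** Bottom-up greedy matching.  Induction on the depth: the mass matched inside
the cells of the last level costs nothing, the residual masses have the same
differences on all coarser cells, and coupling them costs in addition the edge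
weight of the last level times the residual mass of each cell, which is
exactly the discrepancy of that cell. *)
Lemma tree_transport (R : realFieldType) (I : finType) (J : nat -> finType)
    (h : forall l, I -> J l) (w : forall l, J l -> R) :
  (forall l F, 0 <= w l F) ->
  (forall l k i j, (k <= l)%N -> h l i = h l j -> h k i = h k j) ->
  forall (L : nat) (m n : I -> R),
  (forall i, 0 <= m i) -> (forall i, 0 <= n i) -> \sum_i m i = \sum_i n i ->
  exists pi : I -> I -> R,
  [/\ forall i j, 0 <= pi i j,
      forall i, \sum_j pi i j = m i,
      forall j, \sum_i pi i j = n j
    & \sum_i \sum_j pi i j * tree_cost h w L i j <=
      \sum_(l < L) \sum_F w l F * `|cell_mass (h l) m F - cell_mass (h l) n F|].
Proof.
move=> w0 href; elim=> [|L IH] m n m0 n0 mn.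
  pose t := \sum_i m i.
  have mt i : t = 0 -> m i = 0.
    by move/eqP; rewrite psumr_eq0// => /allP/(_ i); rewrite mem_index_enum => /(_ isT)/eqP.
  have nt i : t = 0 -> n i = 0.
    rewrite /t mn; move/eqP.
    by rewrite psumr_eq0// => /allP/(_ i); rewrite mem_index_enum => /(_ isT)/eqP.
  exists (fun i j => m i * n j / t); split.
  - by move=> i j; rewrite divr_ge0 ?mulr_ge0// sumr_ge0.
  - move=> i; rewrite -mulr_suml -mulr_sumr -mn -/t.
    have [t0|tn] := eqVneq t 0; first by rewrite mt// !mul0r.
    by rewrite mulfK.
  - move=> i; rewrite -mulr_suml -mulr_suml -/t.
    have [t0|tn] := eqVneq t 0; first by rewrite nt// mulr0 mul0r.
    by rewrite mulrAC mulfV// mul1r.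
  - rewrite big_ord0 big1// => i _; rewrite big1// => j _.
    by rewrite /tree_cost big_ord0 mulr0.
have [g [g0 gz grow gcol gmass]] := match_within_cells (h L) m0 n0.
pose m' i := m i - \sum_j g i j; pose n' j := n j - \sum_i g i j.
have m'0 i : 0 <= m' i by rewrite subr_ge0.
have n'0 i : 0 <= n' i by rewrite subr_ge0.
have mn' : \sum_i m' i = \sum_i n' i.
  by rewrite /m' /n' !big_split/= mn !sumrN [\sum_i \sum_j g i j]exchange_big.
have massB (l : nat) (u v : I -> R) (F : J l) :
    cell_mass (h l) (fun i => u i - v i) F = cell_mass (h l) u F - cell_mass (h l) v F.
  by rewrite /cell_mass big_split/= sumrN.
have [pi [pi0 pirow picol pic]] := IH _ _ m'0 n'0 mn'.
exists (fun i j => g i j + pi i j); split.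
- by move=> i j; rewrite addr_ge0.
- by move=> i; rewrite big_split/= pirow addrC subrK.
- by move=> i; rewrite big_split/= picol addrC subrK.
have gcost i j : g i j * tree_cost h w L.+1 i j = 0.
  have [hij|hij] := eqVneq (h L i) (h L j); last by rewrite gz// mul0r.
  rewrite /tree_cost big1 ?mulr0// => l _.
  by rewrite (href L l i j)// ?eqxx ?mul0r// -ltnS.
have picost i j : (g i j + pi i j) * tree_cost h w L.+1 i j <=
    pi i j * tree_cost h w L i j + (w L (h L i) * pi i j + w L (h L j) * pi i j).
  rewrite mulrDl gcost add0r /tree_cost big_ord_recr/= mulrDr lerD2l -mulrDl mulrC.
  by rewrite ler_wpM2r//; case: (_ != _); rewrite ?mul1r ?mul0r// addr_ge0.
apply: (@le_trans _ _ (\sum_i \sum_j pi i j * tree_cost h w L i j +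
    (\sum_i w L (h L i) * m' i + \sum_j w L (h L j) * n' j))).
  have -> : \sum_i w L (h L i) * m' i = \sum_i \sum_j w L (h L i) * pi i j.
    by apply: eq_bigr => i _; rewrite -pirow mulr_sumr.
  have -> : \sum_j w L (h L j) * n' j = \sum_i \sum_j w L (h L j) * pi i j.
    by rewrite exchange_big/=; apply: eq_bigr => i _; rewrite -picol mulr_sumr.
  rewrite -!big_split/=; apply: ler_sum => i _.
  by rewrite -!big_split/=; apply: ler_sum => j _; exact: picost.
rewrite big_ord_recr/= lerD//.
  apply: le_trans pic _; apply: ler_sum => l _; apply: ler_sum => F _.
  have gg : cell_mass (h l) (fun i => \sum_j g i j) F = cell_mass (h l) (fun j => \sum_i g i j) F.
    rewrite /cell_mass big_mkcond [RHS]big_mkcond/=.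
    transitivity (\sum_i \sum_j if h l i == F then g i j else 0).
      by apply: eq_bigr => i _; case: ifP => //; rewrite big1.
    rewrite exchange_big/=; apply: eq_bigr => j _.
    transitivity (\sum_i if h l j == F then g i j else 0); last first.
      by case: ifP => //; rewrite big1.
    apply: eq_bigr => i _.
    have [hij|hij] := eqVneq (h L i) (h L j); last by rewrite gz// !if_same.
    by rewrite (href L l i j)// ltnW.
  by rewrite !massB gg opprB addrA subrK.
rewrite (sum_cell_mass (h L) (@w L) m') (sum_cell_mass (h L) (@w L) n') -big_split/=.
apply: ler_sum => F _; rewrite -mulrDr.
rewrite ler_wpM2l// !massB; have [-> ->] := gmass F.
by case: (lerP (cell_mass (h L) m F) (cell_mass (h L) n F)) => H;
  rewrite subrr ?add0r ?addr0 ?ler_norm// distrC ler_norm.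
Qed.

(** * Couplings of measures from couplings of cell masses *)

Lemma measure_probability (R : realType) (d : measure_display) (T : measurableType d)
  (m : {measure set T -> \bar R}) : m setT = 1%E -> exists P : probability T R, forall A, P A = m A.
Proof.
move=> h; exists (mnormalize m (dirac point)) => A.
by rewrite /= /mnormalize h/= onee_eq0 /= invr1 mule1.
Qed.

Lemma measure_fibers (R : realType) (d : measure_display) (T : measurableType d)
    (m : {measure set T -> \bar R}) (I : finType) (g : T -> I) (A : set T) :
  (forall i, measurable (g @^-1` [set i])) -> measurable A ->
  m A = (\sum_i m (A `&` g @^-1` [set i]))%E.
Proof.
move=> mg mA.
have AE : A = \bigcup_(i in [set: I]) (A `&` g @^-1` [set i]).
  by rewrite -setI_bigcupr; apply/seteqP; split => [x Ax|x []]//; split => //; exists (g x).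
rewrite [in LHS]AE measure_fin_bigcup//.
- rewrite fsbig_finite//=; apply/perm_big/uniq_perm;
  rewrite ?finmap.fset_uniq ?index_enum_uniq// => i.
  rewrite in_fset_set; last exact: finite_finset.
  by rewrite mem_index_enum in_setT.
- exact: finite_finset.
- by apply/trivIsetP => i j _ _ ij; apply/seteqP; split => // x [[_ /= gi] [_ /= gj]];
  move: ij; rewrite -gi -gj eqxx.
- by move=> i _; apply: measurableI.
Qed.

(** The mass [pi i j] is spread over the product of the cells [i] and [j]
proportionally to [mu \x nu].  Summing a row gives back [mu] on the cell [i],
because the restriction of [mu] to it is rescaled by [(\sum_j pi i j) / mu i = 1]. *)
Lemma coupling_of_cell_coupling (R : realType) (d : measure_display) (T : measurableType d)
    (mu nu : probability T R) (I : finType) (g : T -> I) (pi : I -> I -> R) :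
  (forall i, measurable (g @^-1` [set i])) ->
  (forall i j, 0 <= pi i j) ->
  (forall i, mu (g @^-1` [set i]) = (\sum_j pi i j)%:E) ->
  (forall j, nu (g @^-1` [set j]) = (\sum_i pi i j)%:E) ->
  exists2 xi : probability (T * T)%type R, couplings mu nu xi &
    forall i j, xi (g @^-1` [set i] `*` g @^-1` [set j]) = (pi i j)%:E.
Proof.
move=> mg pi0 rowE colE.
pose m i := \sum_j pi i j; pose n j := \sum_i pi i j.
have m0 i : 0 <= m i by apply: sumr_ge0.
have n0 j : 0 <= n j by apply: sumr_ge0.
have piml i j : m i = 0 -> pi i j = 0.
  by move/eqP; rewrite psumr_eq0// => /allP/(_ j); rewrite mem_index_enum => /(_ isT)/eqP.
have pinr i j : n j = 0 -> pi i j = 0.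
  by move/eqP; rewrite psumr_eq0// => /allP/(_ i); rewrite mem_index_enum => /(_ isT)/eqP.
pose c (k : I * I) := pi k.1 k.2 / (m k.1 * n k.2).
have c0 k : 0 <= c k by rewrite divr_ge0// mulr_ge0.
(* Cells of mass 0 do not spoil this identity: their rows or columns vanish. *)
have cE i j : c (i, j) * m i * n j = pi i j.
  rewrite /c/=; have [mi|mi] := eqVneq (m i) 0; first by rewrite piml// !mul0r.
  have [nj|nj] := eqVneq (n j) 0; first by rewrite pinr// !mul0r.
  by field; rewrite mi nj.
pose B (k : I * I) := g @^-1` [set k.1] `*` g @^-1` [set k.2].
have mB k : measurable (B k) by apply: measurableX.
pose f (k : nat) : {measure set (T * T) -> \bar R} :=
  if insub k is Some k then
    mscale (NngNum (c0 (enum_val k))) (mrestr (mu \x nu)%E (mB (@enum_val _ [set: I * I]%SET k)))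
  else mzero.
pose x := msum f #|[set: I * I]%SET|.
have xE A : x A = (\sum_i \sum_j (c (i, j))%:E * (mu \x nu) (A `&` B (i, j)))%E.
  rewrite /x /msum pair_big/=.
  transitivity (\sum_(k in [set: I * I]%SET) (c k)%:E * (mu \x nu) (A `&` B k))%E.
    rewrite [RHS]big_enum_val/=; apply: eq_bigr => k _.
    by rewrite /f valK.
  by apply: eq_big => [[i j]|[i j] _]//; rewrite finset.in_setT.
have xXE A1 A2 : measurable A1 -> measurable A2 -> x (A1 `*` A2) =
   (\sum_i \sum_j (c (i, j))%:E * (mu (A1 `&` g @^-1` [set i]) * nu (A2 `&` g @^-1` [set j])))%E.
  move=> m1 m2; rewrite xE; apply: eq_bigr => i _; apply: eq_bigr => j _.
  by rewrite /B/= -setXI product_measure1E//; apply: measurableI.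
have finE (P : probability T R) A : measurable A -> P A = (fine (P A))%:E.
  by move=> mA; rewrite fineK// fin_num_measure.
have le_fine (P : probability T R) A i : measurable A ->
    fine (P (A `&` g @^-1` [set i])) <= fine (P (g @^-1` [set i])).
  move=> mA; rewrite fine_le ?fin_num_measure//; first exact: measurableI.
  by rewrite le_measure// inE//; exact: measurableI.
have x1E A : measurable A -> x (A `*` setT) = mu A.
  move=> mA; rewrite xXE// (measure_fibers mu mg mA); apply: eq_bigr => i _.
  have mAi : measurable (A `&` g @^-1` [set i]) by exact: measurableI.
  rewrite [RHS](finE mu _ mAi) [X in _ = X%:E](_ : _ =
    \sum_j c (i, j) * (fine (mu (A `&` g @^-1` [set i])) * n j)).
    rewrite -sumEFin; apply: eq_bigr => j _; rewrite setTI colE {1}(finE mu _ mAi)//.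
  have [mi0|mi] := eqVneq (m i) 0.
    rewrite big1 => [|j _]; last by rewrite /c /= piml// !mul0r.
    by apply/eqP; rewrite eq_le fine_ge0// andbT (le_trans (le_fine mu A i mA))//
      rowE/= -/(m i) mi0.
  under eq_bigr => j _.
    rewrite (_ : _ * _ = pi i j * (fine (mu (A `&` g @^-1` [set i])) / m i)); last first.
      rewrite -cE; by field.
    over.
  by rewrite -mulr_suml -/(m i) mulrC mulfVK.
have x2E A : measurable A -> x (setT `*` A) = nu A.
  move=> mA; rewrite xXE// (measure_fibers nu mg mA) exchange_big/=; apply: eq_bigr => i _.
  have mAi : measurable (A `&` g @^-1` [set i]) by exact: measurableI.
  rewrite [RHS](finE nu _ mAi) [X in _ = X%:E](_ : _ =
    \sum_j c (j, i) * (m j * fine (nu (A `&` g @^-1` [set i])))).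
    rewrite -sumEFin; apply: eq_bigr => j _; rewrite setTI rowE (finE nu _ mAi)//.
  have [ni0|ni] := eqVneq (n i) 0.
    rewrite big1 => [|j _]; last by rewrite /c /= pinr// !mul0r.
    by apply/eqP; rewrite eq_le fine_ge0// andbT (le_trans (le_fine nu A i mA))//
      colE/= -/(n i) ni0.
  under eq_bigr => j _.
    rewrite (_ : _ * _ = pi j i * (fine (nu (A `&` g @^-1` [set i])) / n i)); last first.
      rewrite -cE; by field.
    over.
  by rewrite -mulr_suml -/(n i) mulrC mulfVK.
have xT : x setT = 1%E by rewrite -setXTT x1E// probability_setT.
have [xi xiE] := measure_probability xT.
exists xi.
  move=> A mA; split; rewrite /pushforward xiE.
    by transitivity (x (A `*` setT)); [congr (x _); apply/seteqP; split => -[a b]//= []|exact: x1E].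
  by transitivity (x (setT `*` A)); [congr (x _); apply/seteqP; split => -[a b]//= []|exact: x2E].
have disj i i' : i' != i -> g @^-1` [set i] `&` g @^-1` [set i'] = set0.
  move=> ii'; apply/seteqP; split => // y [/= gi gi'].
  by move: ii'; rewrite -gi -gi' eqxx.
move=> i j; rewrite xiE; apply: (etrans (xXE _ _ (mg i) (mg j))).
rewrite (bigD1 i)//= (bigD1 j)//= !setIid rowE colE -EFinM.
rewrite [X in (_ + X + _)%E]big1 => [|j' jj']; last by rewrite (disj j)// measure0 !mule0.
rewrite [X in (_ + X)%E]big1 => [|i' ii']; last first.
  by rewrite big1// => j' _; rewrite (disj i)// measure0 mul0e mule0.
by rewrite !adde0 mulrA cE.
Qed.

(** The integral of a nonnegative function is a supremum over the simple
functions below it, so it is monotone even when the integrand is not known to be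
measurable.  This is what makes the expected transport cost tractable: the
infimum over couplings is not shown to be measurable in the sample. *)
Lemma le_integral_of_ge0 (R : realType) (d : measure_display) (T : measurableType d)
    (m : {measure set T -> \bar R}) (f h : T -> \bar R) :
  (forall x, 0 <= f x)%E -> (forall x, f x <= h x)%E ->
  (\int[m]_x f x <= \int[m]_x h x)%E.
Proof.
move=> f0 fh.
have h0 x : (0 <= h x)%E := le_trans (f0 x) (fh x).
rewrite !ge0_integralTE//; apply: le_ereal_sup => _ [k kf <-].
by exists k => // x; apply: le_trans (kf x) (fh x).
Qed.

Lemma integral_marginal (R : realType) (d d' : measure_display)
    (T : measurableType d) (S : measurableType d')
    (m : {measure set S -> \bar R}) (nu : {measure set T -> \bar R})
    (X : S -> T) (f : T -> R) : measurable_fun setT X ->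
  (forall A, measurable A -> pushforward m X A = nu A) ->
  measurable_fun setT f -> (forall x, 0 <= f x) ->
  (\int[m]_z (f (X z))%:E = \int[nu]_x (f x)%:E)%E.
Proof.
move=> mX0.
pose Xm : {mfun S >-> T} := HB.pack X (isMeasurableFun.Build _ _ _ _ X mX0).
rewrite -/(Xm : S -> T) => mX mf f0.
have mEf : measurable_fun setT (EFin \o f) by apply/measurable_EFinP.
rewrite -(@eq_measure_integral _ _ _ setT nu (pushforward m X)); last first.
  by move=> A mA _; exact: mX.
rewrite [RHS]ge0_integral_pushforward// => y _; by rewrite /= lee_fin.
Qed.

(** Links the finite masses of the tree lemma to measures: summing the masses
of the finest cells below [F] gives the measure of [F]. *)
Lemma cell_mass_fibers (R : realType) (d : measure_display) (T : measurableType d)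
    (mu : probability T R) (I J : finType) (g : T -> I) (k : T -> J) (h : I -> J) :
  (forall i, measurable (g @^-1` [set i])) ->
  (forall F, measurable (k @^-1` [set F])) ->
  (forall x, h (g x) = k x) ->
  forall F, cell_mass h (fun i => fine (mu (g @^-1` [set i]))) F
            = fine (mu (k @^-1` [set F])).
Proof.
move=> mg mk hg F; apply: EFin_inj.
rewrite [RHS]fineK ?fin_num_measure// (measure_fibers mu mg (mk F)).
rewrite /cell_mass -sumEFin big_mkcond/=; apply: eq_bigr => i _.
rewrite fineK ?fin_num_measure//.
case: eqP => hi.
  congr (mu _); apply/seteqP; split => [x /= gx|x []//]; split => //=.
  by rewrite -hg gx.
rewrite (_ : _ `&` _ = set0) ?measure0//; apply/seteqP; split => // x [/= kx gx].
by apply: hi; rewrite -gx hg.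
Qed.

(** Continuous form of the tree coupling.  The cost is split as a local part
[phi], which any coupling integrates through its marginals, and a tree part,
which depends only on the pair of finest cells. *)
Lemma tree_transport_measure (R : realType) (d : measure_display) (T : measurableType d)
    (mu nu : probability T R) (J : nat -> finType) (g : forall l, T -> J l)
    (w : forall l, J l -> R) (L : nat) (phi : T -> R) (c : T * T -> R) :
  (forall l F, measurable (g l @^-1` [set F])) ->
  (forall l k x y, (k <= l)%N -> g l x = g l y -> g k x = g k y) ->
  (forall l F, 0 <= w l F) ->
  measurable_fun setT phi -> (forall x, 0 <= phi x) -> (forall z, 0 <= c z) ->
  (forall x y, c (x, y) <= phi x + phi y + tree_cost g w L.+1 x y) ->
  exists2 xi : probability (T * T)%type R, couplings mu nu xi &
    (\int[xi]_z (c z)%:E <= \int[mu]_x (phi x)%:E + \int[nu]_x (phi x)%:E +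
      (\sum_(l < L.+1) \sum_F w l F *
        `|fine (mu (g l @^-1` [set F])) - fine (nu (g l @^-1` [set F]))|)%:E)%E.
Proof.
move=> mg gref w0 mphi phi0 c0 cle.
(* The finest label determines the coarser ones: read them off any point of the
   cell.  Empty cells get the labels of an arbitrary point, which keeps the
   levels nested. *)
pose h l (F : J L) : J l :=
  if pselect (exists x, g L x = F) is left ex then g l (projT1 (cid ex)) else g l point.
have hg l x : (l <= L)%N -> h l (g L x) = g l x.
  move=> lL; rewrite /h; case: pselect => [ex|]; last by case; exists x.
  by case: cid => y /= gy; exact: gref lL gy.
have href l k i j : (k <= l)%N -> h l i = h l j -> h k i = h k j.
  by move=> kl; rewrite /h; case: pselect => ?; case: pselect => ?; exact: gref.
pose m i := fine (mu (g L @^-1` [set i])); pose n i := fine (nu (g L @^-1` [set i])).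
have m0 i : 0 <= m i by rewrite fine_ge0.
have n0 i : 0 <= n i by rewrite fine_ge0.
have tot (P : probability T R) : \sum_i fine (P (g L @^-1` [set i])) = 1.
  apply: EFin_inj; rewrite -sumEFin -(@probability_setT _ _ _ P).
  rewrite (measure_fibers P (mg L) measurableT); apply: eq_bigr => i _.
  by rewrite setTI fineK ?fin_num_measure.
have [pi [pi0 pirow picol picost]] :=
  tree_transport w0 href L.+1 m0 n0 (etrans (tot mu) (esym (tot nu))).
have rowE i : mu (g L @^-1` [set i]) = (\sum_j pi i j)%:E.
  by rewrite pirow fineK ?fin_num_measure.
have colE j : nu (g L @^-1` [set j]) = (\sum_i pi i j)%:E.
  by rewrite picol fineK ?fin_num_measure.
have [xi xic xiE] := coupling_of_cell_coupling (mg L) pi0 rowE colE.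
exists xi => //.
pose B i j := g L @^-1` [set i] `*` g L @^-1` [set j].
have mB i j : measurable (B i j) by exact: measurableX.
pose D i j := tree_cost h w L.+1 i j.
have D0 i j : 0 <= D i j.
  by apply: sumr_ge0 => l _; rewrite mulr_ge0 ?ler0n ?addr_ge0.
have DE x y : tree_cost g w L.+1 x y = D (g L x) (g L y).
  by apply: eq_bigr => l _; rewrite !hg ?leq_ord.
pose S (z : T * T) := \sum_i \sum_j D i j * \1_(B i j) z.
have SE x y : S (x, y) = tree_cost g w L.+1 x y.
  rewrite DE /S (bigD1 (g L x))//= (bigD1 (g L y))//= indicE mem_set// mulr1.
  rewrite [X in _ + X + _]big1 => [|j jy]; last first.
    by rewrite indicE memNset ?mulr0//= => -[/= _ h1]; move: jy; rewrite h1 eqxx.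
  rewrite [X in _ + X]big1 ?addr0// => i ix; rewrite big1// => j _.
  by rewrite indicE memNset ?mulr0//= => -[/= h1 _]; move: ix; rewrite h1 eqxx.
have mphi1 : measurable_fun setT (fun z : T * T => (phi z.1)%:E).
  by apply/measurable_EFinP; apply: measurableT_comp.
have mphi2 : measurable_fun setT (fun z : T * T => (phi z.2)%:E).
  by apply/measurable_EFinP; apply: measurableT_comp.
have mSij i j : measurable_fun setT (fun z : T * T => (D i j * \1_(B i j) z)%:E).
  by apply/measurable_EFinP; apply: measurable_funM => //; exact: measurable_indic.
have Sij0 i j z : (0 <= (D i j * \1_(B i j) z)%:E :> \bar R)%E.
  by rewrite lee_fin mulr_ge0.
have ES z : (S z)%:E = (\sum_i \sum_j (D i j * \1_(B i j) z)%:E)%E.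
  by rewrite -sumEFin; apply: eq_bigr => i _; rewrite -sumEFin.
have mS : measurable_fun setT (fun z : T * T => (S z)%:E).
  rewrite (funext ES); apply: emeasurable_sum => i; exact: emeasurable_sum.
have S0 z : (0 <= (S z)%:E :> \bar R)%E.
  by rewrite ES; apply: sume_ge0 => i _; apply: sume_ge0.
have intS : (\int[xi]_z (S z)%:E = (\sum_i \sum_j pi i j * D i j)%:E)%E.
  under eq_integral do rewrite ES.
  rewrite ge0_integral_sum//; last 2 first.
    by move=> i; exact: emeasurable_sum.
    by move=> i z _; apply: sume_ge0.
  rewrite -sumEFin; apply: eq_bigr => i _.
  rewrite ge0_integral_sum//= -sumEFin; apply: eq_bigr => j _.
  under eq_integral do rewrite EFinM.
  rewrite ge0_integralZl_EFin//; last by apply/measurable_EFinP; exact: measurable_indic.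
  rewrite integral_indic// setIT mulrC EFinM.
  by congr (_ * _)%E; exact: xiE.
apply: (@le_trans _ _ (\int[xi]_z ((phi z.1)%:E + (phi z.2)%:E + (S z)%:E))%E).
  apply: le_integral_of_ge0 => [z|[x y]]; first by rewrite lee_fin.
  by rewrite -!EFinD lee_fin /= SE.
rewrite ge0_integralD//=; last 2 first.
  by move=> z _; rewrite -EFinD lee_fin addr_ge0.
  exact: emeasurable_funD.
rewrite ge0_integralD//=; last 2 first.
  by move=> z _; rewrite lee_fin.
  by move=> z _; rewrite lee_fin.
have mar1 : (\int[xi]_z (phi z.1)%:E = \int[mu]_x (phi x)%:E)%E.
  by apply: (@integral_marginal _ _ _ _ _ _ _ fst phi) => // A mA; have [] := xic A mA.
have mar2 : (\int[xi]_z (phi z.2)%:E = \int[nu]_x (phi x)%:E)%E.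
  by apply: (@integral_marginal _ _ _ _ _ _ _ snd phi) => // A mA; have [] := xic A mA.
rewrite mar1 mar2 leeD2l// intS lee_fin.
apply: le_trans picost _; apply: ler_sum => l _; apply: ler_sum => F _.
by rewrite !(cell_mass_fibers _ (mg L) (mg l))// => x; rewrite hg ?leq_ord.
Qed.

(** * Mixing and the fluctuation of empirical masses *)

Lemma integrable_of_bounded (R : realType) (d : measure_display) (T : measurableType d)
    (P : probability T R) (f : T -> R) (M : R) :
  measurable_fun setT f -> (forall x, `|f x| <= M) ->
  P.-integrable setT (fun x => (f x)%:E).
Proof.
move=> mf fM; apply: (@le_integrable _ _ _ P setT measurableT _ (cst M%:E)).
- exact/measurable_EFinP.
- by move=> x _; rewrite /= lee_fin (le_trans (fM x))// ler_norm.
- by apply: finite_measure_integrable_cst.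
Qed.

Lemma indic_Lfun2 (R : realType) (d : measure_display) (T : measurableType d)
    (P : probability T R) (A : set T) : measurable A ->
  (\1_A : T -> R) \in Lfun P 2%:E.
Proof.
move=> mA; rewrite inE/=; apply/andP; split; rewrite inE//=.
rewrite /finite_norm unlock poweR_lty//.
under eq_integral.
  move=> x _; rewrite (_ : (_ `^ _)%E = (\1_A x)%:E); last first.
    rewrite /= indicE; case: (x \in A) => /=; rewrite ?normr1 ?normr0 ?powR1 ?powR0//.
  over.
by rewrite integral_indic// setIT; exact: (le_lt_trans (probability_le1 _ mA) (ltry _)).
Qed.

Lemma sum_rho_distance (R : realType) (rho : nat -> R) (K : R) (N i : nat) :
  (forall n, 0 <= rho n) -> (forall n, \sum_(0 <= k < n) rho k <= K) -> (i < N)%N ->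
  \sum_(j < N) rho `|i%:Z - j%:Z|%N <= 2 * K.
Proof.
move=> rho0 rhoK iN; rewrite -(big_mkord xpredT (fun j => rho `|i%:Z - j%:Z|%N)).
rewrite (big_cat_nat (leq0n i.+1) iN)/= mulr_natl mulr2n.
apply: lerD.
  rewrite big_nat_rev/= add0n.
  apply: le_trans (rhoK i.+1); rewrite !big_nat; apply: ler_sum => j /andP[_ ji].
  by rewrite subSS (IntDist.distnEl (leq_subr _ _)) subKn.
rewrite -{1}[i.+1]add0n big_addn.
apply: le_trans (rhoK (N - i.+1).+1); rewrite big_nat_recl//= ler_wpDl//.
apply: ler_sum => j _.
by rewrite addnS IntDist.distnEr ?leqW ?leq_addl// subSn ?leq_addl// addnK.
Qed.

(** An indicator of probability [a] has variance [a - a ^+ 2 <= a], the same at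
all times, so the square root in the mixing inequality simplifies to this
variance. *)
Lemma covariance_indic_le (R : realType) (dO dT : measure_display)
    (Omega : measurableType dO) (T : measurableType dT)
    (P : probability Omega R) (mu : probability T R)
    (X : nat -> {RV P >-> T}) (rho : nat -> {nonneg R}) (A : set T) (i j : nat) :
  (forall i : nat, has_law (X i) mu) -> rho_mixing mu X rho -> measurable A ->
  (\int[P]_w ((\1_A (X i w) - fine (mu A)) * (\1_A (X j w) - fine (mu A)))%:E
    <= ((rho `|i%:Z - j%:Z|%N)%:num * fine (mu A))%:E)%E.
Proof.
move=> hX [_ hr] mA.
set a := fine (mu A).
have aE : mu A = a%:E by rewrite fineK// fin_num_measure.
have a0 : 0 <= a by rewrite fine_ge0.
have a1 : a <= 1 by rewrite -lee_fin -aE probability_le1.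
pose B k := X k @^-1` A.
have mB k : measurable (B k) by rewrite -[B k]setTI; apply: measurable_funP.
have fE k : (\1_A : T -> R) \o X k = \1_(B k).
  by apply/funext => w /=; rewrite !indicE /B; congr (_%:R); apply/idP/idP; rewrite !inE.
have PB k : P (B k) = a%:E by rewrite -aE -(hX k A mA).
have EB k : ('E_P[(\1_A : T -> R) \o X k] = a%:E)%E by rewrite fE expectation_indic// PB.
have VB k : ('V_P[(\1_A : T -> R) \o X k] = (a - a ^+ 2)%R%:E)%E.
  rewrite varianceE; last by rewrite fE; exact: indic_Lfun2.
  rewrite EB (_ : (_ ^+ 2)%R = (\1_A : T -> R) \o X k) ?EB ?EFinB//.
  have sq (b : bool) : b%:R * b%:R = b%:R :> R by case: b; rewrite ?mulr1 ?mulr0.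
  by apply/funext => w; rewrite expr2 /= indicE; exact: sq.
have v0 : 0 <= a - a ^+ 2 by rewrite subr_ge0 expr2 ler_piMl.
have := hr _ _ (indic_Lfun2 mu mA) (indic_Lfun2 mu mA) i j.
have -> : (sqrte ('V_P[(\1_A : T -> R) \o X i] * 'V_P[(\1_A : T -> R) \o X j]) =
    (a - a ^+ 2)%R%:E)%E.
  by rewrite !VB /= -expr2 sqrtr_sqr ger0_norm.
rewrite -EFinM.
rewrite unlock !EB unlock /= => h.
apply: le_trans h _; rewrite lee_fin ler_wpM2l// gerBl sqr_ge0//.
Qed.

Lemma empirical_measureE (R : realType) (dO dT : measure_display)
    (Omega : measurableType dO) (T : measurableType dT)
    (P : probability Omega R) (X : nat -> {RV P >-> T}) (N : nat) (w : Omega) (A : set T) :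
  empirical_measure X N w A = (N%:R^-1 * \sum_(i < N) \1_A (X i w))%:E.
Proof.
rewrite /empirical_measure /= /mscale /= /msum EFinM -sumEFin.
by congr (_ * _)%E; apply: eq_bigr => i _; rewrite diracE indicE.
Qed.

(** With [D] the deviation, [|D| <= (t + D ^+ 2 / t) / 2] for every [t > 0], and the
mean of [D ^+ 2] is at most [2 K mu(A) / N] by mixing.  Keeping [t] free replaces
both the Cauchy-Schwarz inequality in the expectation and the one over the
cells of an annulus: a single [t] is chosen later for all cells of a level. *)
Lemma mean_deviation_le (R : realType) (dO dT : measure_display)
    (Omega : measurableType dO) (T : measurableType dT)
    (P : probability Omega R) (mu : probability T R)
    (X : nat -> {RV P >-> T}) (rho : nat -> {nonneg R}) (A : set T) (K t : R) (N : nat) :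
  (forall i : nat, has_law (X i) mu) -> rho_mixing mu X rho -> measurable A ->
  (forall n, \sum_(0 <= k < n) (rho k)%:num <= K) -> (0 < N)%N -> 0 < t ->
  (\int[P]_w (`|fine (empirical_measure X N w A) - fine (mu A)|)%:E
    <= ((t + 2 * K * fine (mu A) / (N%:R * t)) / 2)%:E)%E.
Proof.
move=> hX hr mA hK N0 t0.
set a := fine (mu A).
have a0 : 0 <= a by rewrite fine_ge0.
have Np : 0 < N%:R :> R by rewrite ltr0n.
pose Y i w := \1_A (X i w) - a.
have mY i : measurable_fun setT (Y i).
  apply: measurable_funB => //; apply: measurableT_comp => //; exact: measurable_indic.
have Yb i w : `|Y i w| <= 1 + a.
  rewrite (le_trans (ler_normB _ _))// (ger0_norm a0) lerD2r.
  by rewrite indicE; case: (_ \in _); rewrite ?normr1 ?normr0.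
have intYY i j : P.-integrable setT (fun w => (Y i w * Y j w)%:E).
  apply: (@integrable_of_bounded _ _ _ _ _ ((1 + a) * (1 + a))).
    exact: measurable_funM.
  by move=> w; rewrite normrM ler_pM.
pose c := (2 * t * N%:R ^+ 2)^-1.
have c0 : 0 <= c by rewrite invr_ge0 !mulr_ge0// ?ltW// exprn_gt0.
have intc i j : P.-integrable setT (fun w => c%:E * (Y i w * Y j w)%:E)%E.
  exact: integrableZl.
apply: (@le_trans _ _ (\int[P]_w ((t / 2)%:E +
     \sum_(i < N) \sum_(j < N) c%:E * (Y i w * Y j w)%:E))%E).
  apply: le_integral_of_ge0 => w; first by rewrite lee_fin.
  rewrite empirical_measureE /=.
  set S := _ - _.
  have SE : S = N%:R^-1 * \sum_(i < N) Y i w.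
    rewrite /Y big_split/= mulrDr sumr_const card_ord /S; congr (_ + _).
    by rewrite -[- a *+ N]mulr_natl mulrA mulVf ?gt_eqF// mul1r.
  have -> : (\sum_(i < N) \sum_(j < N) c%:E * (Y i w * Y j w)%:E =
             (c * ((\sum_(i < N) Y i w) * (\sum_(j < N) Y j w)))%:E)%E.
    rewrite mulr_suml mulr_sumr -sumEFin; apply: eq_bigr => i _.
    rewrite !mulr_sumr -sumEFin; apply: eq_bigr => j _.
    by rewrite -EFinM.
  rewrite -EFinD lee_fin.
  have -> : c * ((\sum_(i < N) Y i w) * (\sum_(j < N) Y j w)) = (`|S| ^+ 2 / t) / 2.
    rewrite real_normK ?num_real// SE /c; field; by rewrite !gt_eqF.
  rewrite -mulrDl ler_pdivlMr// -(ler_pM2r t0) mulrDl mulfVK ?gt_eqF//.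
  rewrite -subr_ge0 [X in 0 <= X](_ : _ = (`|S| - t) ^+ 2) ?sqr_ge0//; ring.
rewrite integralD//=; last 2 first.
  exact: finite_measure_integrable_cst.
  by apply: integrable_sum => // i _; exact: integrable_sum.
rewrite integral_cst//= probability_setT mule1.
rewrite integral_sum//; last by move=> i; exact: integrable_sum.
have -> : ((t + 2 * K * a / (N%:R * t)) / 2 = t / 2 + c * (N%:R * (2 * K * a)))%R.
  by rewrite /c; field; rewrite !gt_eqF.
rewrite EFinD leeD2l//.
have -> : c * (N%:R * (2 * K * a)) = \sum_(i < N) c * (2 * K * a).
  by rewrite sumr_const card_ord -[RHS]mulr_natl; ring.
rewrite -sumEFin.
apply: lee_sum => i _.
rewrite integral_sum//.
apply: (@le_trans _ _ (\sum_(j < N) (c * ((rho `|i%:Z - j%:Z|%N)%:num * a))%:E)%E).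
  apply: lee_sum => j _.
  rewrite integralZl// EFinM; apply: lee_wpmul2l; first by rewrite lee_fin.
  exact: covariance_indic_le.
rewrite sumEFin lee_fin -mulr_sumr ler_wpM2l// -mulr_suml ler_wpM2r//.
exact: (@sum_rho_distance _ (fun n => (rho n)%:num)).
Qed.

(** * Dyadic cells inside Euclidean annuli *)

Lemma eucl_norm_ge0 (R : realType) (d : nat) (x : d.-tuple R) : 0 <= eucl_norm x.
Proof. exact: sqrtr_ge0. Qed.

Lemma ler_coord_eucl_norm (R : realType) (d : nat) (x : d.-tuple R) (i : 'I_d) :
  `|tnth x i| <= eucl_norm x.
Proof.
rewrite -sqrtr_sqr ler_sqrt; last by apply: sumr_ge0 => j _; exact: sqr_ge0.
by rewrite (bigD1 i)//= lerDl; apply: sumr_ge0 => j _; exact: sqr_ge0.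
Qed.

Lemma eucl_dist_le (R : realType) (d : nat) (x y : d.-tuple R) (r : R) : 0 <= r ->
  (forall i, `|tnth x i - tnth y i| <= r) -> eucl_dist x y <= Num.sqrt d%:R * r.
Proof.
move=> r0 hr; rewrite -[r in leRHS](ger0_norm r0) -sqrtr_sqr -sqrtrM ?ler0n// ler_sqrt; last first.
  by rewrite mulr_ge0 ?ler0n ?sqr_ge0.
apply: (@le_trans _ _ (\sum_(i < d) r ^+ 2)); last by rewrite sumr_const card_ord mulr_natl.
apply: ler_sum => i _; rewrite tnth_mktuple -real_normK ?num_real//.
by rewrite lerXn2r ?nnegrE.
Qed.

Lemma measurable_eucl_norm (R : realType) (d : nat) :
  measurable_fun setT (@eucl_norm R d).
Proof.
apply: measurableT_comp.
  by apply: continuous_measurable_fun; exact: sqrt_continuous.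
apply: measurable_sum => i; apply: measurable_funX; exact: measurable_tnth.
Qed.

(** Index of the first ball of radius [2 ^+ a] containing [x], capped at [n.+1]
so that this value labels the whole region outside the ball of radius [2 ^+ n]. *)
Definition annulus (R : realType) (d n : nat) (x : d.-tuple R) : nat :=
  find (fun a => eucl_norm x < 2 ^+ a) (iota 0 n.+1).

Lemma annulus_le (R : realType) (d n : nat) (x : d.-tuple R) (k : nat) :
  (annulus n x <= k)%N = (eucl_norm x < 2 ^+ k) || (n < k)%N.
Proof.
have szE : size (iota 0 n.+1) = n.+1 by rewrite size_iota.
have [nk|kn] := ltnP n k.
  by rewrite orbT (leq_trans (find_size _ _)) ?szE.
rewrite orbF; apply/idP/idP => [ak|xk].
  have hs : has (fun a => eucl_norm x < 2 ^+ a) (iota 0 n.+1).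
    by rewrite has_find szE ltnS (leq_trans ak).
  have := nth_find 0%N hs; rewrite nth_iota; last by rewrite ltnS; exact: leq_trans ak kn.
  by move/lt_le_trans; apply; rewrite ler_eXn2l// ltr1n.
rewrite leqNgt; apply/negP => ka.
by have := before_find 0%N ka; rewrite nth_iota ?ltnS// xk.
Qed.

Lemma annulus_leS (R : realType) (d n : nat) (x : d.-tuple R) : (annulus n x <= n.+1)%N.
Proof. by rewrite annulus_le ltnSn orbT. Qed.

Lemma annulus_lt (R : realType) (d n : nat) (x : d.-tuple R) :
  (annulus n x <= n)%N -> eucl_norm x < 2 ^+ annulus n x.
Proof.
by move=> an; have := leqnn (annulus n x); rewrite {1}annulus_le ltnNge an orbF.
Qed.

Lemma annulus_ge (R : realType) (d n : nat) (x : d.-tuple R) (k : nat) :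
  (k < annulus n x)%N -> 2 ^+ k <= eucl_norm x.
Proof. by rewrite ltnNge annulus_le negb_or -leNgt => /andP[]. Qed.

Lemma measurable_annulus (R : realType) (d n k : nat) :
  measurable [set x : d.-tuple R | annulus n x = k].
Proof.
have mle j : measurable [set x : d.-tuple R | (annulus n x <= j)%N].
  under eq_set do rewrite annulus_le.
  have [nj|jn] := ltnP n j.
    by under eq_set do rewrite orbT; rewrite (_ : [set _ | _] = setT)//; apply/seteqP.
  under eq_set do rewrite orbF.
  rewrite (_ : [set _ | _] = @eucl_norm R d @^-1` `]-oo, 2 ^+ j[%classic); last first.
    by apply/seteqP; split => x /=; rewrite in_itv.
  by rewrite -[_ @^-1` _]setTI; exact: measurable_eucl_norm.
case: k => [|k].
  rewrite (_ : [set _ | _] = [set x | (annulus n x <= 0)%N])//.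
  by apply/seteqP; split => x /=; rewrite leqn0 => /eqP.
rewrite (_ : [set _ | _] = [set x | (annulus n x <= k.+1)%N] `\` [set x | (annulus n x <= k)%N]).
  exact: measurableD.
apply/seteqP; split => x /=; first by move=> ->; rewrite leqnn ltnn.
by move=> [a1 /negP]; rewrite -ltnNge => a2; apply/eqP; rewrite eqn_leq a1 a2.
Qed.

(** Position of [x] in the cube of side [2 ^+ a.+1] around the annulus [a],
rescaled to the unit interval.  The constant value outside makes the outer
region a single cell at every level. *)
Definition unit_coord (R : realType) (d n : nat) (x : d.-tuple R) (i : 'I_d) : R :=
  if (annulus n x <= n)%N
  then (tnth x i + 2 ^+ annulus n x) / 2 ^+ (annulus n x).+1 else 0.

Lemma unit_coord_itv (R : realType) (d n : nat) (x : d.-tuple R) (i : 'I_d) :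
  0 <= unit_coord n x i < 1.
Proof.
rewrite /unit_coord; case: ifP => [an|]; last by rewrite lexx ltr01.
have := le_lt_trans (ler_coord_eucl_norm x i) (annulus_lt an).
have p0 : 0 < 2 ^+ (annulus n x) :> R by rewrite exprn_gt0.
rewrite ltr_norml => /andP[h1 h2]; rewrite divr_ge0 ?exprn_ge0//=; last first.
  by rewrite -lerBlDr sub0r ltW.
by rewrite ltr_pdivrMr ?exprn_gt0// mul1r exprS; lra.
Qed.

Definition cell_label (d n l : nat) : finType :=
  ('I_n.+2 * {ffun 'I_d -> 'I_(2 ^ l).-1.+1})%type.

(** At level [l] the cube is cut into [2 ^ l] slices per coordinate.  At level 0
the cells are the annuli themselves. *)
Definition cell (R : realType) (d n l : nat) (x : d.-tuple R) : cell_label d n l :=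
  (inord (annulus n x),
   [ffun i => inord (Num.truncn (2 ^+ l * unit_coord n x i))]).

Lemma cell_eqP (R : realType) (d n l : nat) (x y : d.-tuple R) :
  cell n l x = cell n l y <->
  annulus n x = annulus n y /\
  forall i, Num.truncn (2 ^+ l * unit_coord n x i)
          = Num.truncn (2 ^+ l * unit_coord n y i).
Proof.
have tlt (z : d.-tuple R) i : (Num.truncn (2 ^+ l * unit_coord n z i) < (2 ^ l).-1.+1)%N.
  have /andP[z0 z1] := unit_coord_itv n z i.
  rewrite prednK ?expn_gt0// truncn_lt_nat ?mulr_ge0 ?exprn_ge0//.
  by rewrite natrX -[ltRHS]mulr1 ltr_pM2l ?exprn_gt0.
split=> [[/(congr1 val) + /ffunP h]|[h1 h2]].
  rewrite /= !inordK ?ltnS ?annulus_leS// => -> ; split=> // i.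
  by have /(congr1 val) := h i; rewrite !ffunE /= !inordK.
by rewrite /cell h1; congr pair; apply/ffunP => i; rewrite !ffunE h2.
Qed.

(** Dyadic slices are nested: merging [D] consecutive slices amounts to dividing
their index by [D]. *)
Lemma truncn_divn (R : realType) (D : nat) (v : R) : (0 < D)%N -> 0 <= v ->
  Num.truncn (v / D%:R) = (Num.truncn v %/ D)%N.
Proof.
move=> D0 v0; have Dp : 0 < D%:R :> R by rewrite ltr0n.
apply: truncn_def; rewrite ler_pdivlMr// ltr_pdivrMr// -!natrM.
have /andP[t1 t2] := truncn_itv v0; apply/andP; split.
  by apply: le_trans t1; rewrite ler_nat leq_divM.
by apply: lt_le_trans t2 _; rewrite ler_nat; exact: ltn_ceil.
Qed.

Lemma cell_refine (R : realType) (d n l k : nat) (x y : d.-tuple R) : (k <= l)%N ->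
  cell n l x = cell n l y -> cell n k x = cell n k y.
Proof.
move=> kl /cell_eqP[axy txy]; apply/cell_eqP; split=> // i.
have tE (z : d.-tuple R) : Num.truncn (2 ^+ k * unit_coord n z i) =
    (Num.truncn (2 ^+ l * unit_coord n z i) %/ 2 ^ (l - k))%N.
  have /andP[z0 _] := unit_coord_itv n z i.
  rewrite -truncn_divn ?expn_gt0 ?mulr_ge0 ?exprn_ge0//; congr Num.truncn.
  rewrite natrX (_ : 2 ^+ l = 2 ^+ k * 2 ^+ (l - k) :> R); last by rewrite -exprD subnKC.
  by field; rewrite expf_neq0.
by rewrite !tE txy.
Qed.

Lemma cell_dist (R : realType) (d n l : nat) (x y : d.-tuple R) :
  (annulus n x <= n)%N -> cell n l x = cell n l y ->
  eucl_dist x y <= Num.sqrt d%:R * (2 ^+ (annulus n x).+1 / 2 ^+ l).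
Proof.
move=> an /cell_eqP[axy txy]; apply: eucl_dist_le; first by rewrite divr_ge0 ?exprn_ge0.
move=> i.
set s := 2 ^+ (annulus n x).+1 / 2 ^+ l.
have s0 : 0 < s by rewrite divr_gt0 ?exprn_gt0.
pose u := 2 ^+ l * unit_coord n x i; pose v := 2 ^+ l * unit_coord n y i.
have u0 : 0 <= u by have /andP[? _] := unit_coord_itv n x i; rewrite mulr_ge0 ?exprn_ge0.
have v0 : 0 <= v by have /andP[? _] := unit_coord_itv n y i; rewrite mulr_ge0 ?exprn_ge0.
have -> : tnth x i - tnth y i = s * (u - v).
  rewrite /s /u /v /unit_coord -axy an; field; by rewrite !expf_neq0.
rewrite normrM (gtr0_norm s0) ler_piMr ?(ltW s0)//.
have := truncn_itv u0; have := truncn_itv v0; rewrite /u /v txy -/u -/v.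
set T := Num.truncn _; rewrite -natr1 => /andP[a1 a2] /andP[b1 b2].
by rewrite ler_norml; apply/andP; split; lra.
Qed.

Lemma measurable_cell (R : realType) (d n l : nat) (F : cell_label d n l) :
  measurable (@cell R d n l @^-1` [set F]).
Proof.
have [k [f kf]] : exists k, exists f : 'I_d -> nat, @cell R d n l @^-1` [set F] =
    [set x : d.-tuple R | annulus n x = k] `&`
    (if (k <= n)%N then
       [set x | forall i, (f i)%:R <= 2 ^+ l * ((tnth x i + 2 ^+ k) / 2 ^+ k.+1) < (f i).+1%:R]
     else setT)
    \/ @cell R d n l @^-1` [set F] = set0.
  have [[x0 hx0]|h] := pselect (exists x0 : d.-tuple R, cell n l x0 = F); last first.
    exists 0%N, (fun=> 0%N); right; apply/seteqP; split => // x /= hx; apply: h; by exists x.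
  exists (annulus n x0), (fun i => Num.truncn (2 ^+ l * unit_coord n x0 i)); left.
  apply/seteqP; split => x.
    rewrite /= -hx0 => /cell_eqP[ax tx]; split=> //.
    case: ifP => an //= i; rewrite -tx -ax.
    have /andP[x1 _] := unit_coord_itv n x i.
    have : 0 <= 2 ^+ l * unit_coord n x i by rewrite mulr_ge0 ?exprn_ge0.
    by move/truncn_itv; rewrite {2 3}/unit_coord ax an.
  move=> [/= ax h]; rewrite -hx0; apply/cell_eqP; split=> // i.
  move: h; case: ifP => [an|an _].
    by move=> /(_ i)/truncn_def <-; rewrite {1}/unit_coord ax an.
  by rewrite /unit_coord ax an.
case: kf => -> //; apply: measurableI; first exact: measurable_annulus.
case: ifP => // kn.
rewrite (_ : [set _ | _] = \bigcap_(i in [set: 'I_d])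
   ((fun x : d.-tuple R => 2 ^+ l * ((tnth x i + 2 ^+ k) / 2 ^+ k.+1)) @^-1`
     `[(f i)%:R, (f i).+1%:R[%classic)); last first.
  apply/seteqP; split => x /= h i.
    by move=> _; rewrite /= in_itv/= h.
  by have := h i I; rewrite /= in_itv.
apply: fin_bigcap_measurable => // i _.
rewrite -[_ @^-1` _]setTI.
have mf : measurable_fun setT (fun x : d.-tuple R => 2 ^+ l * ((tnth x i + 2 ^+ k) / 2 ^+ k.+1)).
  apply: measurable_funM => //; apply: measurable_funM => //; apply: measurable_funD => //.
  exact: measurable_tnth.
exact: mf.
Qed.

(** The p-th power of a bound on the diameter of a cell of level [l] in the
annulus [a]. *)
Definition cell_cost (R : realType) (d : nat) (p : R) (a l : nat) : R :=
  (Num.sqrt d%:R * (2 ^+ a.+1 / 2 ^+ l)) `^ p.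

(** Edge weight between a cell of level [l] and its parent, whose diameter is
that of level [l.-1], hence the shifted annulus index.  It vanishes beyond the
depth [dep a] of the annulus and in the outer region: what happens there is
charged to [local_cost]. *)
Definition cell_weight (R : realType) (d : nat) (p : R) (n : nat) (dep : nat -> nat)
    (l : nat) (F : cell_label d n l) : R :=
  if (F.1 <= n)%N && (l <= dep F.1)%N then cell_cost d p F.1.+1 l else 0.

(** Cost charged to a point rather than to a discrepancy: the diameter of its
finest cell, or a multiple of its own norm in the outer region. *)
Definition local_cost (R : realType) (d : nat) (p : R) (n : nat) (dep : nat -> nat)
    (x : d.-tuple R) : R :=
  if (annulus n x <= n)%N then cell_cost d p (annulus n x) (dep (annulus n x))
  else (2 * Num.sqrt d%:R * eucl_norm x) `^ p.

Lemma cell_cost_ge0 (R : realType) (d : nat) (p : R) (a l : nat) : 0 <= cell_cost d p a l.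
Proof. exact: powR_ge0. Qed.

Lemma cell_weight_ge0 (R : realType) (d : nat) (p : R) (n : nat) (dep : nat -> nat)
    (l : nat) (F : cell_label d n l) : 0 <= cell_weight p dep F.
Proof. by rewrite /cell_weight; case: ifP => // _; exact: powR_ge0. Qed.

Lemma local_cost_ge0 (R : realType) (d : nat) (p : R) (n : nat) (dep : nat -> nat)
    (x : d.-tuple R) : 0 <= local_cost p n dep x.
Proof. by rewrite /local_cost; case: ifP => // _; exact: powR_ge0. Qed.

Lemma tree_cost_ge (R : realFieldType) (I : Type) (J : nat -> finType)
    (h : forall l, I -> J l) (w : forall l, J l -> R) (L l : nat) (i j : I) :
  (forall l F, 0 <= w l F) -> (l < L)%N -> h l i != h l j ->
  w l (h l i) + w l (h l j) <= tree_cost h w L i j.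
Proof.
move=> w0 lL hij; rewrite /tree_cost (bigD1 (Ordinal lL))//= hij mul1r lerDl.
by apply: sumr_ge0 => k _; rewrite mulr_ge0 ?ler0n ?addr_ge0.
Qed.

Lemma eucl_distC (R : realType) (d : nat) (x y : d.-tuple R) : eucl_dist x y = eucl_dist y x.
Proof.
rewrite /eucl_dist /eucl_norm; congr Num.sqrt; apply: eq_bigr => i _.
by rewrite !tnth_mktuple -sqrrN opprB.
Qed.

Lemma eucl_dist_le_norm (R : realType) (d : nat) (x y : d.-tuple R) :
  eucl_norm y <= eucl_norm x -> eucl_dist x y <= 2 * Num.sqrt d%:R * eucl_norm x.
Proof.
move=> yx; rewrite mulrAC mulrC; apply: eucl_dist_le.
  by rewrite mulr_ge0 ?eucl_norm_ge0.
move=> i; rewrite (le_trans (ler_normB _ _))// mulr_natl mulr2n lerD ?ler_coord_eucl_norm//.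
by rewrite (le_trans (ler_coord_eucl_norm y i)).
Qed.

Lemma tree_costC (R : realFieldType) (I : Type) (J : nat -> finType)
    (h : forall l, I -> J l) (w : forall l, J l -> R) (L : nat) (i j : I) :
  tree_cost h w L i j = tree_cost h w L j i.
Proof. by apply: eq_bigr => l _; rewrite eq_sym [_ + w l _]addrC. Qed.

Lemma cell_neq_annulus (R : realType) (d n l : nat) (x y : d.-tuple R) :
  annulus n x != annulus n y -> cell n l x != cell n l y.
Proof. by apply: contra_neq => /cell_eqP[]. Qed.

(** If the farther point is outside, its norm controls the distance.  Two
points of different annuli are separated at level 0, and the edge weight there
exceeds the diameter of the larger ball.  Otherwise either the points share
their finest cell, or they are separated at a first level [l] and share the
parent cell of level [l.-1], whose diameter is the weight of level [l]. *)
Lemma dist_powR_le (R : realType) (d : nat) (p : R) (n L : nat) (dep : nat -> nat)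
    (x y : d.-tuple R) : 0 <= p -> (forall a, (a <= n)%N -> (dep a <= L)%N) ->
  eucl_dist x y `^ p <= local_cost p n dep x + local_cost p n dep y +
    tree_cost (@cell R d n) (@cell_weight R d p n dep) L.+1 x y.
Proof.
move=> p0 depL.
wlog yx : x y / eucl_norm y <= eucl_norm x.
  move=> H; have [|/ltW xy] := leP (eucl_norm y) (eucl_norm x); first exact: H.
  by rewrite eucl_distC [local_cost _ _ _ x + _]addrC tree_costC; exact: H.
have dist0 z1 z2 : 0 <= eucl_dist z1 z2 :> R by exact: sqrtr_ge0.
have w0 l F : 0 <= @cell_weight R d p n dep l F by exact: cell_weight_ge0.
have tree0 : 0 <= tree_cost (@cell R d n) (@cell_weight R d p n dep) L.+1 x y.
  by apply: sumr_ge0 => k _; rewrite mulr_ge0 ?ler0n ?addr_ge0.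
have lcx := local_cost_ge0 p n dep x; have lcy := local_cost_ge0 p n dep y.
have powle (u v : R) : 0 <= u -> u <= v -> u `^ p <= v `^ p.
  by move=> u0 uv; apply: ge0_ler_powR => //; rewrite nnegrE// (le_trans u0).
have sd0 : 0 <= Num.sqrt d%:R :> R by exact: sqrtr_ge0.
have [ax|ax] := leqP (annulus n x) n; last first.
  (* As the farther of the two points, x lies outside as soon as y does. *)
  apply: (@le_trans _ _ (local_cost p n dep x)); last by rewrite -addrA lerDl addr_ge0.
  by rewrite /local_cost leqNgt ax /=; apply: powle => //; exact: eucl_dist_le_norm.
have ayx : (annulus n y <= annulus n x)%N.
  by rewrite annulus_le (le_lt_trans yx)// annulus_lt.
have ay : (annulus n y <= n)%N := leq_trans ayx ax.
have [axy|axy] := eqVneq (annulus n x) (annulus n y); last first.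
  have cxy := cell_neq_annulus 0 axy.
  apply: (@le_trans _ _ (tree_cost (@cell R d n) (@cell_weight R d p n dep) L.+1 x y)); last first.
    by rewrite lerDr addr_ge0.
  apply: le_trans (tree_cost_ge w0 (ltn0Sn L) cxy).
  apply: (@le_trans _ _ (cell_weight p dep (cell n 0 x))); last by rewrite lerDl.
  rewrite /cell_weight /= inordK ?ltnS ?annulus_leS// ax leq0n /=.
  apply: powle => //; apply: (le_trans (eucl_dist_le_norm yx)).
  rewrite expr0 divr1 !exprSr (_ : 2 * _ * _ = Num.sqrt d%:R * (2 * eucl_norm x)); last by ring.
  rewrite ler_wpM2l//.
  have := annulus_lt ax; set e := 2 ^+ _; have e0 : 0 < e :> R by rewrite exprn_gt0.
  lra.
have [cxy|cxy] := eqVneq (cell n (dep (annulus n x)) x) (cell n (dep (annulus n x)) y).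
  apply: (@le_trans _ _ (local_cost p n dep x)); last by rewrite -addrA lerDl addr_ge0.
  by rewrite /local_cost ax; apply: powle => //; exact: cell_dist.
have exl : exists l, cell n l x != cell n l y by exists (dep (annulus n x)).
have [l cl lmin] := ex_minnP exl.
have ldep : (l <= dep (annulus n x))%N by exact: lmin.
have lL : (l < L.+1)%N by rewrite ltnS (leq_trans ldep)// depL.
apply: (@le_trans _ _ (tree_cost (@cell R d n) (@cell_weight R d p n dep) L.+1 x y)); last first.
  by rewrite lerDr addr_ge0.
apply: le_trans (tree_cost_ge w0 lL cl).
apply: (@le_trans _ _ (cell_weight p dep (cell n l x))); last by rewrite lerDl.
rewrite /cell_weight /= inordK ?ltnS ?annulus_leS// ax ldep /=.
case: l cl lmin {ldep lL} => [|l] cl lmin.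
  exfalso; move/negP: cl; apply; apply/eqP/cell_eqP; split=> // i.
  rewrite !expr0 !mul1r.
  have truncn0' (z : d.-tuple R) : Num.truncn (unit_coord n z i) = 0%N.
    by apply/eqP; rewrite truncn_eq ?unit_coord_itv//; have /andP[] := unit_coord_itv n z i.
  by rewrite !truncn0'.
apply: powle => //.
have clx : cell n l x = cell n l y.
  by apply/eqP; apply/negPn/negP => /lmin; rewrite ltnn.
apply: (le_trans (cell_dist ax clx)); rewrite ler_wpM2l//.
rewrite [2 ^+ (annulus n x).+2]exprS [2 ^+ l.+1]exprS.
have l0 : 0 < 2 ^+ l :> R by rewrite exprn_gt0.
by rewrite le_eqVlt; apply/orP; left; apply/eqP; field; rewrite gt_eqF.
Qed.

(** * Moments and the local part of the cost *)

Lemma measurable_eucl_norm_powR (R : realType) (d : nat) (q : R) :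
  measurable_fun setT (fun x : d.-tuple R => eucl_norm x `^ q).
Proof.
exact: (measurableT_comp (measurable_powR q) (@measurable_eucl_norm R d)).
Qed.

Lemma moment_ge0 (R : realType) (d : nat) (q Mq : R) (mu : probability (d.-tuple R) R) :
  moment q mu = Mq%:E -> 0 <= Mq.
Proof.
move=> h; rewrite -lee_fin -h; apply: integral_ge0 => x _.
by rewrite lee_fin powR_ge0.
Qed.

Lemma integral_scaled_moment (R : realType) (d : nat) (q Mq c : R)
    (mu : probability (d.-tuple R) R) : 0 <= c -> moment q mu = Mq%:E ->
  (\int[mu]_x (c * eucl_norm x `^ q)%:E = (c * Mq)%:E)%E.
Proof.
move=> c0 h; under eq_integral do rewrite EFinM.
rewrite ge0_integralZl_EFin//.
- by rewrite EFinM -h.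
- by move=> x _; rewrite lee_fin powR_ge0.
- by apply/measurable_EFinP; exact: measurable_eucl_norm_powR.
Qed.

(** Markov inequality: [eucl_norm x >= 2 ^+ k.-1] on the annulus [k > 0], while
the mass of the annulus 0 is at most one. *)
Lemma annulus_mass_le (R : realType) (d : nat) (q Mq : R) (n k : nat)
    (mu : probability (d.-tuple R) R) : 0 < q -> moment q mu = Mq%:E ->
  fine (mu [set x | annulus n x = k]) <= (1 + Mq * 2 `^ q) * (2 ^+ k) `^ (- q).
Proof.
move=> q0 hM; have Mq0 := moment_ge0 hM.
have mA := @measurable_annulus R d n k.
have MM : 0 <= Mq * 2 `^ q by rewrite mulr_ge0// powR_ge0.
case: k mA => [|k] mA.
  rewrite expr0 powR1 mulr1; apply: (@le_trans _ _ 1); last by rewrite lerDl.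
  by rewrite -lee_fin fineK ?fin_num_measure// probability_le1.
apply: (@le_trans _ _ ((2 ^+ k) `^ (- q) * Mq)).
  rewrite -lee_fin fineK ?fin_num_measure// -(integral_scaled_moment (powR_ge0 _ _) hM).
  rewrite -[in leLHS](setIT [set x | _]) -integral_indic//.
  apply: le_integral_of_ge0 => x; first by rewrite lee_fin.
  rewrite lee_fin indicE; have [|] := boolP (x \in _) => [/[!inE]/= ax|_]; last first.
    by rewrite mulr_ge0 ?powR_ge0.
  have xk : 2 ^+ k <= eucl_norm x by apply: (@annulus_ge _ _ n); rewrite ax.
  have p0 : 0 < 2 ^+ k :> R by rewrite exprn_gt0.
  rewrite powRN mulrC ler_pdivlMr ?powR_gt0// mul1r.
  by apply: ge0_ler_powR; rewrite ?nnegrE ?(ltW q0) ?(ltW p0) ?eucl_norm_ge0.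
rewrite exprS powRM ?exprn_ge0// [2 `^ (- q)]powRN mulrDl mulrC.
have g2 : 0 < 2 `^ q :> R by rewrite powR_gt0.
rewrite -[X in _ <= _ + X]mulrA mulVKf ?gt_eqF// lerDr mul1r mulr_ge0 ?powR_ge0//.
Qed.

Lemma measurable_local_cost (R : realType) (d : nat) (p : R) (n : nat) (dep : nat -> nat) :
  measurable_fun setT (@local_cost R d p n dep).
Proof.
rewrite (_ : @local_cost R d p n dep = fun x =>
   \sum_(k < n.+1) cell_cost d p k (dep k) * \1_[set x : d.-tuple R | annulus n x = k] x +
   (2 * Num.sqrt d%:R * eucl_norm x) `^ p * \1_[set x : d.-tuple R | annulus n x = n.+1] x).
  apply: measurable_funD.
    apply: measurable_sum => k; apply: measurable_funM => //.
    by apply: measurable_indic; exact: measurable_annulus.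
  apply: measurable_funM.
    apply: (measurableT_comp (measurable_powR p)); apply: measurable_funM => //.
    exact: measurable_eucl_norm.
  by apply: measurable_indic; exact: measurable_annulus.
apply/funext => x; rewrite /local_cost.
case: ifPn => [an|]; last first.
  rewrite -ltnNge => na; rewrite big1 => [|k _]; last first.
    by rewrite indicE memNset ?mulr0//= => ak; move: na; rewrite ak ltnNge leq_ord.
  rewrite add0r indicE mem_set ?mulr1//=.
  by apply/eqP; rewrite eqn_leq na annulus_leS.
have an1 : (annulus n x < n.+1)%N by rewrite ltnS.
rewrite [X in _ + X](_ : _ = 0) ?addr0; last first.
  by rewrite indicE memNset ?mulr0//= => ak; move: an1; rewrite ak ltnn.
rewrite (bigD1 (Ordinal an1))//= indicE mem_set// mulr1 big1 ?addr0// => k kn.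
rewrite indicE memNset ?mulr0//= => ak; move: kn; rewrite -val_eqE /= ak eqxx//.
Qed.

(** In the outer region [|x|^p <= 2^(n (p - q)) |x|^q], so that the moment of
order [q] controls the tail. *)
Lemma integral_local_cost_le (R : realType) (d : nat) (p q Mq : R) (n : nat) (dep : nat -> nat)
    (mu : probability (d.-tuple R) R) : 0 < p -> p < q -> moment q mu = Mq%:E ->
  (\int[mu]_x (local_cost p n dep x)%:E <=
   (\sum_(k < n.+1) cell_cost d p k (dep k) * ((1 + Mq * 2 `^ q) * (2 ^+ k) `^ (- q)) +
    (2 * Num.sqrt d%:R) `^ p * (2 ^+ n) `^ (p - q) * Mq)%:E)%E.
Proof.
move=> p0 pq hM; have q0 : 0 < q by exact: lt_trans pq.
set c := (2 * Num.sqrt d%:R) `^ p * (2 ^+ n) `^ (p - q).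
have c0 : 0 <= c by rewrite mulr_ge0 ?powR_ge0.
pose A k := [set x : d.-tuple R | annulus n x = k].
have mA k : measurable (A k) by exact: measurable_annulus.
apply: (@le_trans _ _ (\int[mu]_x (\sum_(k < n.+1) (cell_cost d p k (dep k))%:E * (\1_(A k) x)%:E
     + (c * eucl_norm x `^ q)%:E))%E).
  apply: le_integral_of_ge0 => x; first by rewrite lee_fin local_cost_ge0.
  under eq_bigr do rewrite -EFinM.
  rewrite sumEFin -EFinD lee_fin /local_cost; case: ifPn => [an|].
    have an1 : (annulus n x < n.+1)%N by rewrite ltnS.
    rewrite (bigD1 (Ordinal an1))//= indicE mem_set// mulr1 -addrA lerDl addr_ge0//.
      by apply: sumr_ge0 => k _; rewrite mulr_ge0 ?cell_cost_ge0.
    by rewrite mulr_ge0 ?powR_ge0.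
  rewrite -ltnNge => /annulus_ge nx.
  apply: (@le_trans _ _ (c * eucl_norm x `^ q)); last first.
    by rewrite lerDr; apply: sumr_ge0 => k _; rewrite mulr_ge0 ?cell_cost_ge0.
  have n0 : 0 < 2 ^+ n :> R by rewrite exprn_gt0.
  have x0 : 0 < eucl_norm x := lt_le_trans n0 nx.
  rewrite powRM ?eucl_norm_ge0 ?mulr_ge0 ?sqrtr_ge0// /c -mulrA ler_wpM2l ?powR_ge0//.
  have -> : eucl_norm x `^ p = eucl_norm x `^ (p - q) * eucl_norm x `^ q.
    by rewrite -powRD ?subrK// gt_eqF ?implybT.
  rewrite ler_wpM2r ?powR_ge0//.
  rewrite -opprB !powRN lef_pV2 ?posrE ?powR_gt0//.
  apply: ge0_ler_powR => //; first by rewrite subr_ge0 ltW.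
  - by rewrite nnegrE ltW.
  - by rewrite nnegrE ltW.
rewrite ge0_integralD//=; last 4 first.
- by move=> x _; apply: sume_ge0 => k _; rewrite -EFinM lee_fin mulr_ge0 ?cell_cost_ge0.
- apply: emeasurable_sum => k; apply/measurable_EFinP.
  by apply: measurable_funM => //; exact: measurable_indic.
- by move=> x _; rewrite lee_fin mulr_ge0 ?powR_ge0.
- by apply/measurable_EFinP; apply: measurable_funM => //; exact: measurable_eucl_norm_powR.
rewrite (integral_scaled_moment c0 hM) EFinD leeD2r// -sumEFin ge0_integral_sum//; last 2 first.
- move=> k; apply/measurable_EFinP.
  by apply: measurable_funM => //; exact: measurable_indic.
- by move=> k x _; rewrite -EFinM lee_fin mulr_ge0 ?cell_cost_ge0.
apply: lee_sum => k _; rewrite ge0_integralZl_EFin ?cell_cost_ge0//; last first.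
  by apply/measurable_EFinP; exact: measurable_indic.
rewrite EFinM; apply: lee_wpmul2l; first by rewrite lee_fin cell_cost_ge0.
rewrite integral_indic// setIT.
apply: (@le_trans _ _ (fine (mu (A k)))%:E); first by rewrite fineK// fin_num_measure.
by rewrite lee_fin annulus_mass_le.
Qed.

(** * Expected cost of the tree coupling *)

Lemma transport_cost_le (R : realType) (d : nat) (p : R) (n L : nat) (dep : nat -> nat)
    (alpha : {measure set (d.-tuple R) -> \bar R}) (mu : probability (d.-tuple R) R) :
  0 <= p -> (forall a, (a <= n)%N -> (dep a <= L)%N) -> alpha setT = 1%E ->
  (transport_cost p alpha mu <=
    \int[alpha]_x (local_cost p n dep x)%:E + \int[mu]_x (local_cost p n dep x)%:E +
    (\sum_(l < L.+1) \sum_(F : cell_label d n l) cell_weight p dep F *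
      `|fine (alpha (cell n l @^-1` [set F])) - fine (mu (cell n l @^-1` [set F]))|)%:E)%E.
Proof.
move=> p0 depL alpha1.
have [nu nuE] := measure_probability alpha1.
have [xi xic xile] := @tree_transport_measure R _ _ nu mu (cell_label d n) (@cell R d n)
  (@cell_weight R d p n dep) L (local_cost p n dep)
  (fun z => eucl_dist z.1 z.2 `^ p) (@measurable_cell R d n)
  (fun l k x y => @cell_refine R d n l k x y) (fun l F => cell_weight_ge0 p dep F)
  (@measurable_local_cost R d p n dep) (@local_cost_ge0 R d p n dep) (fun z => powR_ge0 _ _)
  (fun x y => dist_powR_le x y p0 depL).
apply: (@le_trans _ _ (\int[xi]_z (eucl_dist z.1 z.2 `^ p)%:E)%E).
  apply: ereal_inf_lbound; exists xi => // A mA.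
  by have [h1 h2] := xic A mA; split => //; rewrite h1; exact: nuE.
apply: (le_trans xile).
have -> : (\int[nu]_x (local_cost p n dep x)%:E = \int[alpha]_x (local_cost p n dep x)%:E)%E.
  by apply: eq_measure_integral => A _ _; exact: nuE.
rewrite leeD2l// lee_fin; apply: ler_sum => l _; apply: ler_sum => F _.
by rewrite nuE.
Qed.

Lemma integral_empirical (R : realType) (dO dT : measure_display)
    (Omega : measurableType dO) (T : measurableType dT)
    (P : probability Omega R) (X : nat -> {RV P >-> T}) (N : nat) (w : Omega) (f : T -> R) :
  measurable_fun setT f -> (forall x, 0 <= f x) ->
  (\int[empirical_measure X N w]_x (f x)%:E = (N%:R^-1 * \sum_(i < N) f (X i w))%:E)%E.
Proof.
move=> mf f0.
have mEf : measurable_fun setT (fun x => (f x)%:E) by apply/measurable_EFinP.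
rewrite /empirical_measure ge0_integral_mscale//; last by move=> x _; rewrite lee_fin.
rewrite ge0_integral_measure_sum//; last by move=> x _; rewrite lee_fin.
rewrite EFinM -sumEFin; congr (_ * _)%E; apply: eq_bigr => i _.
by rewrite integral_dirac// diracE in_setT mul1e.
Qed.

Lemma expected_integral_empirical (R : realType) (dO dT : measure_display)
    (Omega : measurableType dO) (T : measurableType dT)
    (P : probability Omega R) (mu : probability T R)
    (X : nat -> {RV P >-> T}) (N : nat) (f : T -> R) :
  (forall i : nat, has_law (X i) mu) -> (0 < N)%N ->
  measurable_fun setT f -> (forall x, 0 <= f x) ->
  (\int[P]_w (N%:R^-1 * \sum_(i < N) f (X i w))%:E = \int[mu]_x (f x)%:E)%E.
Proof.
move=> hX N0 mf f0.
have mfX i : measurable_fun setT (fun w => f (X i w)) by exact: measurableT_comp.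
under eq_integral do rewrite EFinM -sumEFin.
rewrite ge0_integralZl_EFin//; last 2 first.
- by move=> w _; apply: sume_ge0 => i _; rewrite lee_fin.
- by apply: emeasurable_sum => i; apply/measurable_EFinP.
rewrite ge0_integral_sum//; last 2 first.
- by move=> i; apply/measurable_EFinP.
- by move=> i w _; rewrite lee_fin.
have hI i : (\int[P]_w (f (X i w))%:E = \int[mu]_x (f x)%:E)%E.
  by apply: integral_marginal => // A mA; exact: hX.
rewrite (eq_bigr (fun=> \int[mu]_x (f x)%:E)%E)//.
have I0 : (0 <= \int[mu]_x (f x)%:E)%E by apply: integral_ge0 => x _; rewrite lee_fin.
have Np : 0 < N%:R :> R by rewrite ltr0n.
case: (\int[mu]_x (f x)%:E)%E I0 => [r _|_|//].
  rewrite sumEFin sumr_const card_ord -EFinM; congr (_%:E).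
  by rewrite -[r *+ N]mulr_natl mulKf// gt_eqF.
case: N N0 Np => // N _ Np; rewrite big_ord_recl addye; last first.
  by rewrite gt_eqF// (@lt_le_trans _ _ 0%E)// sume_ge0.
by rewrite mulry gtr0_sg ?mul1e// invr_gt0.
Qed.

Lemma card_cells (R : realType) (d n l : nat) (k : 'I_n.+2) :
  cell_mass (fun F : cell_label d n l => F.1) (fun=> 1 : R) k = (2 ^+ l) ^+ d.
Proof.
rewrite /cell_mass.
transitivity (\sum_(a | a == k) \sum_(c : {ffun 'I_d -> 'I_(2 ^ l).-1.+1}) (1 : R)).
  by rewrite pair_big/=; apply: eq_bigl => -[a c] /=; rewrite andbT.
rewrite big_pred1_eq sumr_const card_ffun !card_ord prednK ?expn_gt0//.
by rewrite !natrX.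
Qed.

Lemma mass_annulus_cells (R : realType) (d n l : nat) (mu : probability (d.-tuple R) R)
    (k : 'I_n.+2) :
  cell_mass (fun F : cell_label d n l => F.1)
    (fun F => fine (mu (cell n l @^-1` [set F]))) k =
  fine (mu [set x | annulus n x = k]).
Proof.
have kE (j : 'I_n.+2) : (fun x : d.-tuple R => inord (annulus n x) : 'I_n.+2) @^-1` [set j] =
    [set x | annulus n x = j].
  apply/seteqP; split => x /=.
    by move=> <-; rewrite inordK// ltnS annulus_leS.
  by move=> ->; rewrite inord_val.
rewrite -kE; apply: (@cell_mass_fibers R _ _ mu _ _ (@cell R d n l)) => // F.
  exact: measurable_cell.
by rewrite kE; exact: measurable_annulus.
Qed.

(** Integrates the deterministic bound.  The local cost has the same mean under
[mu_N] and [mu], hence the factor 2; the discrepancies of all cells of level [l]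
in the annulus [k] are estimated with the same parameter [t k l]. *)
Lemma expected_transport_le (R : realType) (d : nat) (p : R) (rho : nat -> {nonneg R})
    (dO : measure_display) (Omega : measurableType dO)
    (P : probability Omega R) (mu : probability (d.-tuple R) R)
    (X : nat -> {RV P >-> d.-tuple R}) (K I : R) (N n : nat) (dep : nat -> nat)
    (t : nat -> nat -> R) :
  0 <= p -> (forall i : nat, has_law (X i) mu) -> rho_mixing mu X rho ->
  (forall n, \sum_(0 <= k < n) (rho k)%:num <= K) -> (0 < N)%N ->
  (forall k l, 0 < t k l) ->
  (\int[mu]_x (local_cost p n dep x)%:E <= I%:E)%E ->
  (\int[P]_w transport_cost p (empirical_measure X N w) mu <=
   (2 * I + \sum_(k < n.+1) \sum_(l < (dep k).+1) cell_cost d p k.+1 l *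
      (((2 ^+ l) ^+ d * t k l +
        2 * K * fine (mu [set x | annulus n x = k]) / (N%:R * t k l)) / 2))%:E)%E.
Proof.
move=> p0 hX hr hK N0 t0 hI.
pose L := (\max_(k < n.+1) dep k)%N.
have depL a : (a <= n)%N -> (dep a <= L)%N.
  by rewrite -ltnS => an; apply: (leq_bigmax (Ordinal an)).
have Np : 0 < N%:R :> R by rewrite ltr0n.
pose phi := @local_cost R d p n dep.
have phi0 x : 0 <= phi x by exact: local_cost_ge0.
have mphi : measurable_fun setT phi by exact: measurable_local_cost.
pose Dev l (F : cell_label d n l) w : R :=
  `|fine (empirical_measure X N w (cell n l @^-1` [set F]))
    - fine (mu (cell n l @^-1` [set F]))|.
have mDev l F : measurable_fun setT (@Dev l F).
  apply: measurableT_comp => //; apply: measurable_funB => //.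
  under eq_fun do rewrite empirical_measureE /=.
  apply: measurable_funM => //; apply: measurable_sum => i.
  apply: measurableT_comp => //; apply: measurable_indic; exact: measurable_cell.
pose W l F : R := @cell_weight R d p n dep l F.
have W0 l F : 0 <= @W l F by exact: cell_weight_ge0.
have mWD l F : measurable_fun setT (fun w => (W l F * Dev l F w)%:E).
  by apply/measurable_EFinP; apply: measurable_funM.
have WD0 l F w : (0 <= (W l F * Dev l F w)%:E)%E by rewrite lee_fin mulr_ge0 ?normr_ge0.
have mWDl l : measurable_fun setT (fun w => \sum_F (W l F * Dev l F w)%:E)%E.
  exact: emeasurable_sum.
have WDl0 l w : (0 <= \sum_F (W l F * Dev l F w)%:E)%E by exact: sume_ge0.
have I0 : 0 <= I.
  by rewrite -lee_fin (le_trans _ hI)//; apply: integral_ge0 => x _; rewrite lee_fin.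
have mE : measurable_fun setT (fun w => (N%:R^-1 * \sum_(i < N) phi (X i w))%:E).
  apply/measurable_EFinP; apply: measurable_funM => //; apply: measurable_sum => i.
  exact: measurableT_comp.
have E0 w : (0 <= (N%:R^-1 * \sum_(i < N) phi (X i w))%:E)%E.
  by rewrite lee_fin mulr_ge0 ?invr_ge0 ?(ltW Np)// sumr_ge0.
apply: (@le_trans _ _ (\int[P]_w ((N%:R^-1 * \sum_(i < N) phi (X i w))%:E + I%:E +
     \sum_(l < L.+1) \sum_F (W l F * Dev l F w)%:E))%E).
  apply: le_integral_of_ge0 => w.
    by apply: le_ereal_inf_tmp => _ [xi _ <-]; apply: integral_ge0 => z _; rewrite lee_fin powR_ge0.
  have emp1 : empirical_measure X N w setT = 1%E.
    rewrite empirical_measureE; under eq_bigr do rewrite indicT.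
    by rewrite sumr_const card_ord mulVf// gt_eqF.
  apply: (le_trans (transport_cost_le mu p0 depL emp1)).
  rewrite (integral_empirical X N w mphi phi0); apply: leeD.
    exact: leeD2l.
  by rewrite -sumEFin; apply: lee_sum => l _; rewrite -sumEFin.
rewrite ge0_integralD//=; last 4 first.
- by move=> w _; rewrite adde_ge0.
- exact: emeasurable_funD.
- by move=> w _; apply: sume_ge0 => l _; exact: WDl0.
- apply: emeasurable_sum => l; exact: mWDl.
rewrite ge0_integralD//= (expected_integral_empirical hX N0 mphi phi0).
rewrite integral_cst//= probability_setT mule1.
rewrite ge0_integral_sum//; last 2 first.
- by move=> l; exact: mWDl.
- by move=> l w _; exact: WDl0.
rewrite EFinD; apply: leeD.
  by rewrite mulr_natl mulr2n EFinD leeD2r.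
pose B (k l : nat) : R := (((2 ^+ l) ^+ d * t k l +
        2 * K * fine (mu [set x | annulus n x = k]) / (N%:R * t k l)) / 2).
apply: (@le_trans _ _ (\sum_(l < L.+1) (\sum_(k < n.+2)
    (if (k <= n)%N && (l <= dep k)%N then cell_cost d p k.+1 l * B k l else 0))%:E)%E).
  apply: lee_sum => l _; rewrite ge0_integral_sum//.
  pose v (k : 'I_n.+2) : R := if (k <= n)%N && (l <= dep k)%N then cell_cost d p k.+1 l else 0.
  apply: (@le_trans _ _ (\sum_(F : cell_label d n l) (v F.1 * t F.1 l / 2 * 1 +
       v F.1 * K / (N%:R * t F.1 l) * fine (mu (cell n l @^-1` [set F])))%:E)%E).
    apply: lee_sum => F _; under eq_integral do rewrite EFinM.
    rewrite ge0_integralZl_EFin//; last 2 first.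
    - by move=> w _; rewrite lee_fin normr_ge0.
    - by apply/measurable_EFinP.
    have := mean_deviation_le hX hr (measurable_cell F) hK N0 (t0 F.1 l).
    move=> /(lee_wpmul2l (_ : 0%:E <= (W l F)%:E)%E) /=.
    rewrite lee_fin => /(_ (W0 l F)) h.
    apply: (le_trans h); rewrite -EFinM lee_fin /W /cell_weight -/(v F.1) le_eqVlt; apply/orP; left.
    by apply/eqP; field; rewrite !gt_eqF.
  rewrite sumEFin lee_fin big_split/=.
  rewrite (sum_cell_mass (fun F : cell_label d n l => F.1) (fun k => v k * t k l / 2) (fun=> 1)).
  rewrite (sum_cell_mass (fun F : cell_label d n l => F.1)
     (fun k => v k * K / (N%:R * t k l)) (fun F => fine (mu (cell n l @^-1` [set F])))).
  rewrite -big_split/=; apply: ler_sum => k _; rewrite card_cells mass_annulus_cells.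
  rewrite /v; case: ifP => _; last by rewrite !mul0r addr0.
  by rewrite /B le_eqVlt; apply/orP; left; apply/eqP; field; rewrite !gt_eqF.
rewrite sumEFin lee_fin exchange_big/= big_ord_recr/= ltnn/= [X in _ + X]big1// addr0.
apply: ler_sum => k _; rewrite -ltnS ltn_ord/=.
have dk : ((dep k).+1 <= L.+1)%N by rewrite ltnS depL// -ltnS.
rewrite (big_ord_widen _ (fun l => cell_cost d p k.+1 l * B k l) dk) -big_mkcond/=.
by under [leRHS]eq_bigl do rewrite ltnS.
Qed.

(** * Summation over scales *)

Lemma pow2D (R : realType) (a b : R) : 2 `^ (a + b) = 2 `^ a * 2 `^ b :> R.
Proof. by rewrite powRD// pnatr_eq0 implybT. Qed.

Lemma ler_pow2 (R : realType) (a b : R) : a <= b -> 2 `^ a <= 2 `^ b :> R.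
Proof. by move=> ab; apply: ler_powR => //; rewrite ler1n. Qed.

Lemma pow2_gt0 (R : realType) (a : R) : 0 < 2 `^ a :> R.
Proof. exact: powR_gt0. Qed.

Lemma pow2_gt1 (R : realType) (a : R) : 0 < a -> 1 < 2 `^ a :> R.
Proof.
move=> a0; have : 1 `^ a < 2 `^ a :> R by apply: gt0_ltr_powR; rewrite ?nnegrE ?ltr1n.
by rewrite powR1.
Qed.

Lemma geometric_growing (R : realType) (r : R) : 0 < r ->
  exists2 C : R, 0 <= C & forall n : nat, \sum_(k < n.+1) 2 `^ (r * k%:R) <= C * 2 `^ (r * n%:R).
Proof.
move=> r0; have g1 := pow2_gt1 r0.
have g0 : 0 < 2 `^ r - 1 :> R by rewrite subr_gt0.
exists (2 `^ r / (2 `^ r - 1)); first by rewrite divr_ge0 ?ltW// powR_ge0.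
elim=> [|n IH]; first by rewrite big_ord1 ler_peMl ?powR_ge0// ler_pdivlMr//; lra.
rewrite big_ord_recr/=; apply: le_trans (lerD IH (lexx _)) _.
rewrite -[n.+1%:R]natr1 mulrDr mulr1 pow2D.
by rewrite le_eqVlt; apply/orP; left; apply/eqP; field; rewrite gt_eqF.
Qed.

Lemma geometric_decaying (R : realType) (r : R) : r < 0 ->
  exists2 C : R, 0 <= C & forall n : nat, \sum_(k < n.+1) 2 `^ (r * k%:R) <= C.
Proof.
move=> r0; have g1 : 2 `^ r < 1 :> R.
  have := pow2_gt1 (_ : 0 < - r); rewrite powRN oppr_gt0 => /(_ r0).
  by rewrite invf_gt1// pow2_gt0.
have g0 : 0 < 1 - 2 `^ r :> R by rewrite subr_gt0.
exists (1 - 2 `^ r)^-1; first by rewrite invr_ge0 ltW.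
move=> n; have -> : \sum_(k < n.+1) 2 `^ (r * k%:R) =
    (1 - 2 `^ r)^-1 * (1 - 2 `^ (r * n.+1%:R)) :> R.
  elim: n => [|n IH].
    by rewrite big_ord1 mulr0 powRr0 mulr1 mulVf// gt_eqF.
  rewrite big_ord_recr/= IH -[n.+2%:R]natr1 [r * (_ + 1)]mulrDr mulr1 pow2D.
  by field; rewrite gt_eqF.
by rewrite ler_piMr ?invr_ge0 ?(ltW g0)// gerBl powR_ge0.
Qed.

Lemma geometric_sum (R : realType) (r q : R) : r != 0 -> 0 < q ->
  exists2 C : R, 0 <= C & forall (lam : R) (n : nat), n%:R <= lam / q + 1 ->
    \sum_(k < n.+1) 2 `^ (r * k%:R) <= C * (1 + 2 `^ (r * lam / q)).
Proof.
move=> rn q0; have [r0|r0|/eqP] := ltgtP r 0; last by rewrite (negbTE rn).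
  have [C C0 hC] := geometric_decaying r0; exists C => // lam n _.
  by rewrite (le_trans (hC n))// ler_peMr// lerDl powR_ge0.
have [C C0 hC] := geometric_growing r0; exists (C * 2 `^ r); first by rewrite mulr_ge0 ?powR_ge0.
move=> lam n hn; rewrite (le_trans (hC n))// -mulrA ler_wpM2l// mulrDr mulr1 -pow2D.
rewrite ler_wpDl ?powR_ge0// ler_pow2//.
by rewrite -mulrA -{2}[r]mulr1 -mulrDr ler_pM2l// addrC.
Qed.

(** Order of magnitude of the expected cost with [N = 2^lam], [D] the dimension
and [dep k] the depth in the annulus [k]: first the cost inside the finest cells, then
the fluctuations of all cells of level [l]. *)
Definition scale_sum (R : realType) (D p q lam : R) (n : nat) (dep : nat -> nat) : R :=
  \sum_(k < n.+1) (2 `^ (p * k%:R - q * k%:R - p * (dep k)%:R) +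
    \sum_(l < (dep k).+1) 2 `^ (p * k%:R - q * k%:R / 2 - lam / 2 + (D / 2 - p) * l%:R)).

(** Says that [2^(D dep_k)] is of order [2^(lam - q k)], the expected number of
sample points in the annulus [k].  The shift [q / D] keeps the depth
nonnegative up to [n <= lam / q + 1]. *)
Definition good_depth (R : realType) (D q lam : R) (n : nat) (dep : nat -> nat) : Prop :=
  forall k : nat, (k <= n)%N ->
    (lam - q * k%:R) / D + q / D <= (dep k)%:R <= (lam - q * k%:R) / D + q / D + 1.

(** Reduces each regime to one dominating sequence [f] over the annuli. *)
Lemma scale_sum_le (R : realType) (D p q lam : R) (n : nat) (dep : nat -> nat)
    (f : nat -> R) (A : R) :
  (forall k, (k <= n)%N -> 2 `^ (p * k%:R - q * k%:R - p * (dep k)%:R) <= f k) ->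
  (forall k, (k <= n)%N -> 2 `^ (p * k%:R - q * k%:R / 2 - lam / 2) *
     (\sum_(l < (dep k).+1) 2 `^ ((D / 2 - p) * l%:R)) <= A * f k) ->
  scale_sum D p q lam n dep <= (1 + A) * \sum_(k < n.+1) f k.
Proof.
move=> h1 h2; rewrite mulr_sumr; apply: ler_sum => k _.
have kn : (k <= n)%N by rewrite -ltnS.
rewrite mulrDl mul1r lerD ?h1//; apply: le_trans (h2 k kn).
by rewrite mulr_sumr le_eqVlt; apply/orP; left; apply/eqP; apply: eq_bigr => l _; rewrite -pow2D.
Qed.

(** As soon as [D / 2 <= p], the finest cells cost no more than the fluctuation
of the annulus itself, the term [l = 0]. *)
Lemma coarse_term_le (R : realType) (D p q lam : R) (n : nat) (dep : nat -> nat) (k : nat) :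
  0 < D -> D / 2 <= p -> 0 < q -> good_depth D q lam n dep -> (k <= n)%N ->
  2 `^ (p * k%:R - q * k%:R - p * (dep k)%:R) <=
  2 `^ (- (lam / 2)) * 2 `^ ((p - q / 2) * k%:R) :> R.
Proof.
move=> D0 Dp q0 /(_ k) hd kn; have /andP[d1 _] := hd kn.
rewrite -pow2D ler_pow2//.
have : D / 2 * (dep k)%:R <= p * (dep k)%:R by rewrite ler_wpM2r.
have : (lam - q * k%:R) / D <= (dep k)%:R.
  by apply: le_trans d1; rewrite lerDl divr_ge0 ?ltW.
rewrite ler_pdivrMr// => h; move: h; set x := (dep k)%:R; set K := k%:R; nra.
Qed.

(** The coarse levels dominate: the sum over [l] is bounded uniformly in the
depth, and the sum over [k] has exponent [p - q / 2]. *)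
Lemma scale_sum_high (R : realType) (D p q : R) : 0 < D -> D / 2 < p -> 0 < q -> q != 2 * p ->
  exists2 C : R, 0 <= C & forall (lam : R) (n : nat) (dep : nat -> nat),
    n%:R <= lam / q + 1 -> good_depth D q lam n dep ->
    scale_sum D p q lam n dep <= C * (2 `^ (- (lam / 2)) + 2 `^ (- (lam * ((q - p) / q)))).
Proof.
move=> D0 Dp q0 qp.
have r0 : p - q / 2 != 0 by apply: contra_neq qp; lra.
have [C1 C10 hC1] := geometric_sum r0 q0.
have [C2 C20 hC2] := @geometric_decaying _ (D / 2 - p) (ltac:(lra)).
exists ((1 + C2) * C1); first by rewrite mulr_ge0// addr_ge0.
move=> lam n dep hn hd.
apply: (le_trans (@scale_sum_le _ D p q lam n dep
   (fun k => 2 `^ (- (lam / 2)) * 2 `^ ((p - q / 2) * k%:R)) C2 _ _)).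
- by move=> k kn; apply: coarse_term_le hd kn => //; exact: ltW.
- move=> k kn; rewrite mulrC; apply: ler_pM.
  + by apply: sumr_ge0 => l _; rewrite powR_ge0.
  + exact: powR_ge0.
  + exact: hC2.
  + by rewrite -pow2D ler_pow2//; lra.
rewrite -mulr_sumr -mulrA ler_wpM2l ?addr_ge0//.
apply: (@le_trans _ _ (2 `^ (- (lam / 2)) * (C1 * (1 + 2 `^ ((p - q / 2) * lam / q))))).
  by rewrite ler_wpM2l ?powR_ge0 ?hC1.
rewrite mulrCA ler_wpM2l// mulrDr mulr1 -pow2D lerD2l ler_pow2//.
by rewrite le_eqVlt; apply/orP; left; apply/eqP; field; rewrite gt_eqF.
Qed.

(** The fine levels dominate: the sum over [l] is of the order of its last term,
which the choice of depth makes comparable to the cost inside the finest cells,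
and the sum over [k] has exponent [p - q + p q / D]. *)
Lemma scale_sum_low (R : realType) (D p q : R) : 0 < D -> 0 < p -> p < D / 2 -> 0 < q ->
  q != D * p / (D - p) ->
  exists2 C : R, 0 <= C & forall (lam : R) (n : nat) (dep : nat -> nat),
    n%:R <= lam / q + 1 -> good_depth D q lam n dep ->
    scale_sum D p q lam n dep <= C * (2 `^ (- (lam * (p / D))) + 2 `^ (- (lam * ((q - p) / q)))).
Proof.
move=> D0 p0 Dp q0 qp; have Dpn : D - p != 0 by rewrite gt_eqF//; lra.
pose r := p - q + p * q / D.
have r0 : r != 0.
  apply: contra_neq qp; rewrite /r => h.
  apply: (mulIf Dpn); rewrite mulfVK//.
  have : D * (p - q + p * q / D) = 0 by rewrite h mulr0.
  rewrite (_ : D * _ = D * p - q * (D - p)); first by move/subr0_eq => ->; rewrite mulrC.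
  by field; rewrite gt_eqF.
have [C1 C10 hC1] := geometric_sum r0 q0.
have [C2 C20 hC2] := @geometric_growing _ (D / 2 - p) (ltac:(lra)).
pose c := 2 `^ ((D / 2 - p) * (q / D + 1)) : R.
have c0 : 0 <= C2 * c by rewrite mulr_ge0 ?powR_ge0.
exists ((1 + C2 * c) * C1); first by rewrite mulr_ge0// addr_ge0.
move=> lam n dep hn hd.
apply: (le_trans (@scale_sum_le _ D p q lam n dep
   (fun k => 2 `^ (- (lam * (p / D))) * 2 `^ (r * k%:R)) (C2 * c) _ _)).
- move=> k kn; have /andP[d1 _] := hd k kn.
  rewrite -pow2D ler_pow2//.
  have h : (lam - q * k%:R) / D <= (dep k)%:R.
    by apply: le_trans d1; rewrite lerDl divr_ge0 ?ltW.
  have {}h : p * ((lam - q * k%:R) / D) <= p * (dep k)%:R by rewrite ler_pM2l.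
  rewrite (_ : - (lam * (p / D)) + r * k%:R = p * k%:R - q * k%:R - p * ((lam - q * k%:R) / D)).
    by rewrite lerD2l lerN2.
  by rewrite /r; field; rewrite gt_eqF.
- move=> k kn; have /andP[_ d2] := hd k kn.
  apply: (@le_trans _ _ (2 `^ (p * k%:R - q * k%:R / 2 - lam / 2) *
     (C2 * 2 `^ ((D / 2 - p) * (dep k)%:R)))); first by rewrite ler_wpM2l ?powR_ge0.
  rewrite mulrCA -[leRHS]mulrA ler_wpM2l// /c -!pow2D ler_pow2//.
  have h : (D / 2 - p) * (dep k)%:R <= (D / 2 - p) * ((lam - q * k%:R) / D + q / D + 1).
    by rewrite ler_wpM2l//; lra.
  rewrite -lerBrDl; apply: (le_trans h); rewrite /r.
  by rewrite le_eqVlt; apply/orP; left; apply/eqP; field; rewrite gt_eqF.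
rewrite -mulr_sumr -mulrA ler_wpM2l ?addr_ge0//.
apply: (@le_trans _ _ (2 `^ (- (lam * (p / D))) * (C1 * (1 + 2 `^ (r * lam / q))))).
  by rewrite ler_wpM2l ?powR_ge0 ?hC1.
rewrite mulrCA ler_wpM2l// mulrDr mulr1 -pow2D lerD2l ler_pow2// /r.
by rewrite le_eqVlt; apply/orP; left; apply/eqP; field; rewrite !gt_eqF.
Qed.

(** All levels of an annulus contribute equally, so the depth [dep k], of order
[(lam - q k) / D], appears as a factor.  When the exponent [r = p - q / 2] is
negative the inner annuli dominate, and this factor is the logarithm of the
rate.  When [r] is positive the outer annuli dominate, where the depth is bounded;
it is then absorbed, at the price of half of the exponent, by a geometric sum
[2^(eta l)] with [eta = r D / (2 q)]. *)
Lemma scale_sum_critical (R : realType) (D p q : R) : 0 < D -> p = D / 2 -> 0 < q -> q != 2 * p ->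
  exists2 C : R, 0 <= C & forall (lam : R) (n : nat) (dep : nat -> nat), 0 <= lam ->
    n%:R <= lam / q + 1 -> good_depth D q lam n dep ->
    scale_sum D p q lam n dep <=
      C * (2 `^ (- (lam / 2)) * (lam + 1) + 2 `^ (- (lam * ((q - p) / q)))).
Proof.
move=> D0 Dp q0 qp.
have Dp0 : D / 2 - p = 0 by rewrite Dp subrr.
pose r := p - q / 2.
have rn0 : r != 0 by apply: contra_neq qp; rewrite /r; lra.
have [r0|r0|/eqP] := ltgtP r 0; last by rewrite (negbTE rn0).
  have [C1 C10 hC1] := geometric_decaying r0.
  pose A := 2 + q / D + D^-1.
  have A0 : 0 <= A by rewrite !addr_ge0 ?divr_ge0 ?invr_ge0 ?ltW.
  exists ((1 + A) * C1); first by rewrite mulr_ge0// addr_ge0.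
  move=> lam n dep lam0 hn hd.
  pose B := 2 `^ (- (lam / 2)) * (lam + 1) : R.
  have B0 : 0 <= B by rewrite mulr_ge0 ?powR_ge0 ?addr_ge0.
  apply: (le_trans (@scale_sum_le _ D p q lam n dep (fun k => B * 2 `^ (r * k%:R)) A _ _)).
  - move=> k kn; apply: (le_trans (@coarse_term_le _ D p q lam n dep k D0 _ q0 hd kn)).
      by rewrite Dp.
    by rewrite ler_wpM2r ?powR_ge0// ler_peMr ?powR_ge0// lerDr.
  - move=> k kn; have /andP[_ d2] := hd k kn.
    rewrite (eq_bigr (fun=> 1)); last by move=> l _; rewrite Dp0 mul0r powRr0.
    rewrite sumr_const card_ord -[(dep k).+1%:R]natr1.
    have -> : p * k%:R - q * k%:R / 2 - lam / 2 = - (lam / 2) + r * k%:R by rewrite /r; field.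
    rewrite pow2D /B.
    rewrite [leRHS](_ : _ = 2 `^ (- (lam / 2)) * 2 `^ (r * k%:R) * (A * (lam + 1))); last by ring.
    rewrite ler_wpM2l ?mulr_ge0 ?powR_ge0//.
    apply: (@le_trans _ _ (lam / D + q / D + 1 + 1)).
      rewrite lerD2r (le_trans d2)// lerD2r lerD2r ler_pM2r ?invr_gt0//.
      by rewrite gerBl mulr_ge0 ?(ltW q0).
    have h1 : 0 <= (2 + q / D) * lam by rewrite mulr_ge0 ?addr_ge0 ?divr_ge0 ?(ltW q0) ?(ltW D0).
    have h2 : 0 <= D^-1 by rewrite invr_ge0 ltW.
    rewrite /A [leRHS](_ : _ = lam / D + q / D + 1 + 1 + ((2 + q / D) * lam + D^-1)); last by ring.
    by rewrite lerDl addr_ge0.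
  have A1 : 0 <= 1 + A by exact: addr_ge0.
  rewrite -mulr_sumr -[leRHS]mulrA (ler_wpM2l A1)// mulrC.
  apply: (@le_trans _ _ (C1 * B)); first by rewrite ler_wpM2r.
  by rewrite ler_wpM2l// lerDl powR_ge0.
have r20 : 0 < r / 2 by rewrite divr_gt0.
have [C1 C10 hC1] := geometric_growing r20.
pose eta := r * D / (2 * q).
have eta0 : 0 < eta by rewrite divr_gt0 ?mulr_gt0.
have [C2 C20 hC2] := geometric_growing eta0.
pose c := C2 * 2 `^ (eta * (q / D + 1)).
have c0 : 0 <= c by rewrite mulr_ge0 ?powR_ge0.
exists ((1 + c) * (C1 * 2 `^ r)); first by rewrite !mulr_ge0 ?addr_ge0 ?powR_ge0.
move=> lam n dep lam0 hn hd.
pose B := 2 `^ (- (lam / 2) + r / 2 * (lam / q) + r / 2) : R.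
have B0 : 0 <= B by exact: powR_ge0.
apply: (le_trans (@scale_sum_le _ D p q lam n dep (fun k => B * 2 `^ (r / 2 * k%:R)) c _ _)).
- move=> k kn; apply: (le_trans (@coarse_term_le _ D p q lam n dep k D0 _ q0 hd kn)).
    by rewrite Dp.
  rewrite -!pow2D ler_pow2// -/r.
  have kl : k%:R <= lam / q + 1 by apply: le_trans hn; rewrite ler_nat.
  have : r / 2 * k%:R <= r / 2 * (lam / q + 1) by rewrite ler_wpM2l// ltW.
  by rewrite mulrDr mulr1; lra.
- move=> k kn; have /andP[_ d2] := hd k kn.
  apply: (@le_trans _ _ (2 `^ (p * k%:R - q * k%:R / 2 - lam / 2) *
      (C2 * 2 `^ (eta * (dep k)%:R)))).
    rewrite ler_wpM2l ?powR_ge0//; apply: le_trans (hC2 _); apply: ler_sum => l _.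
    by rewrite ler_pow2// Dp0 mul0r mulr_ge0// ltW.
  rewrite /c /B mulrCA -[leRHS]mulrA ler_wpM2l// -!pow2D ler_pow2//.
  have h : eta * (dep k)%:R <= eta * ((lam - q * k%:R) / D + q / D + 1).
    by rewrite ler_wpM2l// ltW.
  rewrite -lerBrDl; apply: (le_trans h).
  rewrite -subr_ge0 [X in 0 <= X](_ : _ = r / 2); first by rewrite ltW.
  by rewrite /eta /r; field; rewrite !gt_eqF.
rewrite -mulr_sumr -[leRHS]mulrA ler_wpM2l ?addr_ge0//.
apply: (@le_trans _ _ (B * (C1 * 2 `^ (r / 2 * n%:R)))); first by rewrite ler_wpM2l.
rewrite mulrCA -[leRHS]mulrA ler_wpM2l// mulrDr.
rewrite ler_wpDl ?mulr_ge0 ?powR_ge0 ?addr_ge0//.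
rewrite /B -!pow2D ler_pow2//.
have h : r / 2 * n%:R <= r / 2 * (lam / q + 1) by rewrite ler_wpM2l// ltW.
rewrite -lerBrDl; apply: (le_trans h).
by rewrite le_eqVlt; apply/orP; left; apply/eqP; rewrite /r; field; rewrite !gt_eqF.
Qed.

(** * Rates *)

Lemma exprn_powR (R : realType) (k : nat) (r : R) : (2 ^+ k) `^ r = 2 `^ (r * k%:R) :> R.
Proof. by rewrite -powR_mulrn// -powRrM mulrC. Qed.

Lemma cell_costE (R : realType) (d : nat) (p : R) (a l : nat) :
  cell_cost d p a l = Num.sqrt d%:R `^ p * 2 `^ (p * (a.+1%:R - l%:R)).
Proof.
rewrite /cell_cost powRM ?sqrtr_ge0 ?divr_ge0 ?exprn_ge0//; congr (_ * _).
by rewrite -!powR_mulrn// -powRN -pow2D -powRrM mulrC.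
Qed.

(** The parameter [t k l = 2^(- l d / 2 - q k / 2) N^(-1/2)] is the square root of
(mass bound of the annulus / (N * number of cells)), which balances both terms
of [mean_deviation_le] summed over the cells. *)
Lemma expected_transport_scale_sum (R : realType) (d : nat) (p q Mq K : R)
    (rho : nat -> {nonneg R}) :
  (0 < d)%N -> 0 < p -> p < q -> (forall n, \sum_(0 <= k < n) (rho k)%:num <= K) ->
  exists2 C : R, 0 <= C &
  forall (dO : measure_display) (Omega : measurableType dO)
         (P : probability Omega R) (mu : probability (d.-tuple R) R)
         (X : nat -> {RV P >-> d.-tuple R}),
    (forall i : nat, has_law (X i) mu) -> rho_mixing mu X rho -> moment q mu = Mq%:E ->
  forall (lam : R) (N n : nat) (dep : nat -> nat), (0 < N)%N -> N%:R = 2 `^ lam ->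
    (\int[P]_w transport_cost p (empirical_measure X N w) mu <=
     (C * (scale_sum d%:R p q lam n dep + 2 `^ ((p - q) * n%:R)))%:E)%E.
Proof.
move=> d0 p0 pq hK; have q0 : 0 < q := lt_trans p0 pq.
have K0 : 0 <= K by have := hK 0; rewrite big_geq.
have [Mq0|Mq0] := ltP Mq 0.
  by exists 0 => // dO Omega P mu X _ _ /moment_ge0; rewrite leNgt Mq0.
pose C0 := Num.sqrt d%:R `^ p : R.
pose M := 1 + Mq * 2 `^ q.
have M0 : 0 <= M by rewrite addr_ge0// mulr_ge0// powR_ge0.
have C00 : 0 <= C0 by exact: powR_ge0.
pose c1 := 2 * C0 * 2 `^ p * M.
pose c2 := C0 * 2 `^ (2 * p) * ((1 + 2 * K * M) / 2).
pose c3 := 2 * (2 * Num.sqrt d%:R) `^ p * Mq.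
have c10 : 0 <= c1 by rewrite !mulr_ge0 ?powR_ge0.
have c20 : 0 <= c2 by rewrite !mulr_ge0 ?powR_ge0 ?addr_ge0 ?mulr_ge0.
have c30 : 0 <= c3 by rewrite !mulr_ge0 ?powR_ge0.
exists (c1 + c2 + c3); first by rewrite !addr_ge0.
move=> dO Omega P mu X hX hr hM lam N n dep N0 NE.
pose t (k l : nat) : R := 2 `^ (- (d%:R / 2 * l%:R) - q * k%:R / 2 - lam / 2).
have t0 k l : 0 < t k l by exact: pow2_gt0.
have hI := integral_local_cost_le n dep p0 pq hM.
apply: (le_trans (expected_transport_le (ltW p0) hX hr hK N0 t0 hI)).
rewrite lee_fin.
pose u (k : nat) : R := 2 `^ (p * k%:R - q * k%:R - p * (dep k)%:R).
pose v (k l : nat) : R := 2 `^ (p * k%:R - q * k%:R / 2 - lam / 2 + (d%:R / 2 - p) * l%:R).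
pose z : R := 2 `^ ((p - q) * n%:R).
have u0 k : 0 <= u k by exact: powR_ge0.
have v0 k l : 0 <= v k l by exact: powR_ge0.
have z0 : 0 <= z by exact: powR_ge0.
have uE k : 2 * (cell_cost d p k (dep k) * (M * (2 ^+ k) `^ (- q))) = c1 * u k.
  rewrite cell_costE exprn_powR /c1 /u -/C0.
  have -> : p * (k.+1%:R - (dep k)%:R) = p + (p * k%:R - p * (dep k)%:R).
    by rewrite -[k.+1%:R]natr1; ring.
  have -> : p * k%:R - q * k%:R - p * (dep k)%:R = (p * k%:R - p * (dep k)%:R) + - q * k%:R.
    by ring.
  rewrite [2 `^ (p + _)]pow2D [2 `^ (_ + - q * _)]pow2D; ring.
have vE k l : (k <= n)%N -> cell_cost d p k.+1 l * (((2 ^+ l) ^+ d * t k l +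
      2 * K * fine (mu [set x | annulus n x = k]) / (N%:R * t k l)) / 2) <= c2 * v k l.
  move=> kn; have tN : t k l != 0 by rewrite gt_eqF.
  pose s : R := 2 `^ (d%:R / 2 * l%:R - q * k%:R / 2 - lam / 2).
  have e1 : (2 ^+ l) ^+ d * t k l = s.
    rewrite /t /s -exprM -powR_mulrn// -pow2D natrM; congr (_ `^ _).
    by field.
  have e2 : 2 `^ (- q * k%:R) / (N%:R * t k l) = s.
    rewrite NE /t /s -!pow2D -powRN -pow2D; congr (_ `^ _); by field.
  have mk := annulus_mass_le n k q0 hM.
  have e3 : fine (mu [set x | annulus n x = k]) / (N%:R * t k l) <= M * s.
    rewrite -e2 mulrA ler_wpM2r ?invr_ge0 ?mulr_ge0 ?(ltW (t0 _ _))//.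
    by rewrite -exprn_powR.
  have s0 : 0 <= s by exact: powR_ge0.
  rewrite e1 cell_costE -/C0.
  have -> : c2 * v k l = C0 * 2 `^ (p * (k.+2%:R - l%:R)) * ((s + 2 * K * (M * s)) / 2).
    rewrite /c2 /v (_ : p * (k.+2%:R - l%:R) = 2 * p + p * (k%:R - l%:R)); last first.
      by rewrite -[k.+2%:R]natr1 -[k.+1%:R]natr1; ring.
    have -> : 2 `^ (p * k%:R - q * k%:R / 2 - lam / 2 + (d%:R / 2 - p) * l%:R) =
      2 `^ (p * (k%:R - l%:R)) * s.
      by rewrite /s -pow2D; congr (_ `^ _); ring.
    by rewrite [2 `^ (2 * p + _)]pow2D; field.
  rewrite ler_wpM2l ?mulr_ge0 ?powR_ge0// ler_wpM2r// lerD2l -mulrA ler_wpM2l//.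
  by rewrite mulr_ge0.
have zE : 2 * ((2 * Num.sqrt d%:R) `^ p * (2 ^+ n) `^ (p - q) * Mq) = c3 * z.
  by rewrite exprn_powR /c3 /z; ring.
apply: (@le_trans _ _ (\sum_(k < n.+1) (c1 * u k + \sum_(l < (dep k).+1) c2 * v k l) + c3 * z)).
  rewrite mulrDr zE [X in X <= _]addrAC lerD2r mulr_sumr -big_split/=; apply: ler_sum => k _.
  rewrite uE lerD2l; apply: ler_sum => l _; apply: vE.
  by rewrite -ltnS.
rewrite mulrDr; apply: lerD; last by rewrite ler_wpM2r// lerDr addr_ge0.
rewrite /scale_sum mulr_sumr; apply: ler_sum => k _.
rewrite mulrDr; apply: lerD; first by rewrite ler_wpM2r// -addrA lerDl addr_ge0.
rewrite -mulr_sumr ler_wpM2r ?sumr_ge0//.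
by rewrite [c1 + c2]addrC -addrA lerDl addr_ge0.
Qed.

Lemma good_depth_exists (R : realType) (D q lam : R) (n : nat) :
  0 < D -> 0 < q -> n%:R <= lam / q + 1 -> exists dep : nat -> nat, good_depth D q lam n dep.
Proof.
move=> D0 q0 hn.
exists (fun k => Num.truncn ((lam - q * k%:R) / D + q / D + 1)) => k kn.
have kl : k%:R <= lam / q + 1 by apply: le_trans hn; rewrite ler_nat.
have h : 0 <= (lam - q * k%:R) / D + q / D.
  rewrite -mulrDl divr_ge0 ?(ltW D0)//.
  have : q * k%:R <= q * (lam / q + 1) by rewrite ler_pM2l.
  rewrite mulrDr mulr1 mulrCA mulfV ?gt_eqF// mulr1; lra.
have /truncn_itv : 0 <= (lam - q * k%:R) / D + q / D + 1 by rewrite addr_ge0.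
set T := Num.truncn _; rewrite -natr1 => /andP[h1 h2].
by rewrite h1 andbT; move: h2; rewrite ltrD2r => /ltW.
Qed.

Lemma natr_pow2_ln (R : realType) (N : nat) : (0 < N)%N ->
  N%:R = 2 `^ (ln N%:R / ln 2) :> R.
Proof.
move=> N0; have l2 : 0 < ln 2 :> R by rewrite ln_gt0// ltr1n.
by rewrite /powR pnatr_eq0/= mulfVK ?gt_eqF// lnK// posrE ltr0n.
Qed.

(** Common end of the three regimes: [n] is chosen with [2^n] of order [N^(1/q)],
which turns the outer region into [N^(-(q-p)/q)]. *)
Lemma expected_transport_rate (R : realType) (d : nat) (p q Mq K C2 : R)
    (rho : nat -> {nonneg R}) (rate : R -> R) :
  (0 < d)%N -> 0 < p -> p < q -> (forall n, \sum_(0 <= k < n) (rho k)%:num <= K) ->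
  0 <= C2 -> (forall lam, 0 <= lam -> 0 <= rate lam) ->
  (forall (lam : R) (n : nat) (dep : nat -> nat), 0 <= lam ->
    n%:R <= lam / q + 1 -> good_depth d%:R q lam n dep ->
    scale_sum d%:R p q lam n dep <= C2 * (rate lam + 2 `^ (- (lam * ((q - p) / q))))) ->
  exists2 C : R, 0 <= C &
  forall (dO : measure_display) (Omega : measurableType dO)
         (P : probability Omega R) (mu : probability (d.-tuple R) R)
         (X : nat -> {RV P >-> d.-tuple R}),
    (forall i : nat, has_law (X i) mu) -> rho_mixing mu X rho -> moment q mu = Mq%:E ->
  forall N : nat, (0 < N)%N ->
    (\int[P]_w transport_cost p (empirical_measure X N w) mu <=
     (C * (rate (ln N%:R / ln 2) + N%:R `^ (- ((q - p) / q))))%:E)%E.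
Proof.
move=> d0 p0 pq hK C20 rate0 hS; have q0 : 0 < q := lt_trans p0 pq.
have [C1 C10 hC1] := @expected_transport_scale_sum _ d p q Mq K rho d0 p0 pq hK.
exists (C1 * (C2 + 1)); first by rewrite mulr_ge0// addr_ge0.
move=> dO Omega P mu X hX hr hM N N0.
set lam := ln N%:R / ln 2.
have l2 : 0 < ln 2 :> R by rewrite ln_gt0// ltr1n.
have lam0 : 0 <= lam by rewrite divr_ge0 ?(ltW l2)// ln_ge0// ler1n.
have NE : N%:R = 2 `^ lam :> R by exact: natr_pow2_ln.
have [n [n1 n2]] : exists n : nat, lam / q <= n%:R /\ n%:R <= lam / q + 1.
  exists (Num.truncn (lam / q)).+1.
  have /truncn_itv/andP[h1 h2] : 0 <= lam / q by rewrite divr_ge0 ?(ltW q0).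
  by split; [exact: ltW|rewrite -natr1 lerD2r].
have Dp : 0 < d%:R :> R by rewrite ltr0n.
have [dep hdep] := good_depth_exists Dp q0 n2.
apply: (le_trans (hC1 _ _ P mu X hX hr hM lam N n dep N0 NE)).
rewrite lee_fin -mulrA ler_wpM2l//.
have NqE : N%:R `^ (- ((q - p) / q)) = 2 `^ (- (lam * ((q - p) / q))).
  by rewrite NE -powRrM mulrN.
rewrite NqE [leRHS]mulrDl mul1r; apply: lerD; first exact: hS.
rewrite ler_wpDl ?rate0// ler_pow2//.
rewrite mulrCA -mulNr opprB ler_wnM2l// subr_le0; exact: ltW.
Qed.

(** The shift by one in [ln (1 + N)] keeps the logarithm of the rate away from 0
at [N = 1]. *)
Lemma log2_le_ln1p (R : realType) (N : nat) : (0 < N)%N ->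
  ln N%:R / ln 2 + 1 <= 2 / ln 2 * ln (1 + N%:R) :> R.
Proof.
move=> N0; have Np : 0 < N%:R :> R by rewrite ltr0n.
have l2 : 0 < ln 2 :> R by rewrite ln_gt0// ltr1n.
rewrite mulrAC ler_pdivlMr// mulrDl mulfVK ?gt_eqF// mul1r.
rewrite mulr_natl mulr2n; apply: lerD; rewrite ler_ln ?posrE ?addr_gt0//.
  by rewrite lerDr.
have : 1 <= N%:R :> R by rewrite ler1n.
by move=> N1; lra.
Qed.

Unset Implicit Arguments.

Theorem theorem14 (R : realType) (d : nat) (hd : (1 <= d)%N)
    (p q : R) (hp : 0 < p) (hpq : p < q) (Mq : R)
    (rho : nat -> {nonneg R})
    (hrho : (\sum_(0 <= n <oo) (rho n)%:num%:E < +oo)%E) :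
  exists C : R,
  forall (dO : measure_display) (Omega : measurableType dO)
         (P : probability Omega R) (mu : probability (d.-tuple R) R)
         (X : nat -> {RV P >-> d.-tuple R}),
    stationary X ->
    (forall i : nat, has_law (X i) mu) ->
    rho_mixing mu X rho ->
    moment q mu = Mq%:E ->
  forall N : nat, (1 <= N)%N ->
    let ET := (\int[P]_w transport_cost p (empirical_measure X N w) mu)%E in
    let n : R := N%:R in
    [/\ d%:R / 2 < p -> q != 2 * p ->
          (ET <= (C * (n `^ (- (1 / 2)) + n `^ (- ((q - p) / q))))%:E)%E,
        p = d%:R / 2 -> q != 2 * p ->
          (ET <= (C * (n `^ (- (1 / 2)) * ln (1 + n)
                       + n `^ (- ((q - p) / q))))%:E)%E
      & p < d%:R / 2 -> q != d%:R * p / (d%:R - p) ->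
          (ET <= (C * (n `^ (- (p / d%:R)) + n `^ (- ((q - p) / q))))%:E)%E].
Proof.
have q0 : 0 < q := lt_trans hp hpq.
have d0 : 0 < d%:R :> R by rewrite ltr0n.
have [K hK] : exists K, forall n, \sum_(0 <= k < n) (rho k)%:num <= K.
  exists (fine (\sum_(0 <= n <oo) (rho n)%:num%:E)%E) => n.
  rewrite -lee_fin fineK; last first.
    by rewrite ge0_fin_numE//; apply: nneseries_ge0.
  by rewrite -sumEFin; apply: nneseries_lim_ge.
pose bound (C : R) (H : Prop) (f : nat -> R) :=
  forall (dO : measure_display) (Omega : measurableType dO)
         (P : probability Omega R) (mu : probability (d.-tuple R) R)
         (X : nat -> {RV P >-> d.-tuple R}),
    (forall i : nat, has_law (X i) mu) -> rho_mixing mu X rho -> moment q mu = Mq%:E ->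
  forall N : nat, (0 < N)%N -> H ->
    (\int[P]_w transport_cost p (empirical_measure X N w) mu <=
     (C * (f N + N%:R `^ (- ((q - p) / q))))%:E)%E.
have powN (N : nat) (a : R) : (0 < N)%N -> N%:R `^ a = 2 `^ (ln N%:R / ln 2 * a).
  by move=> N0; rewrite [in LHS](natr_pow2_ln R N0) -powRrM.
have ln1p0 (N : nat) : 0 <= ln (1 + N%:R) :> R by rewrite ln_ge0// lerDl.
have [C1 C10 h1] : exists2 C : R, 0 <= C &
    bound C (d%:R / 2 < p /\ q != 2 * p) (fun N => N%:R `^ (- (1 / 2))).
  have [[hdp hqp]|nH] := pselect (d%:R / 2 < p /\ q != 2 * p); last by exists 0.
  have [C2 C20 hC2] := scale_sum_high d0 hdp q0 hqp.
  have [C C0 hC] := @expected_transport_rate R d p q Mq K C2 rho (fun lam => 2 `^ (- (lam / 2)))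
    hd hp hpq hK C20 (fun lam _ => powR_ge0 _ _) (fun lam n dep _ => hC2 lam n dep).
  exists C => // dO Omega P mu X hX hr hM N N0 _; apply: (le_trans (hC _ _ P mu X hX hr hM N N0)).
  by rewrite [N%:R `^ (- (1 / 2))]powN// mul1r mulrN.
have [C2 C20 h2] : exists2 C : R, 0 <= C &
    bound C (p = d%:R / 2 /\ q != 2 * p) (fun N => N%:R `^ (- (1 / 2)) * ln (1 + N%:R)).
  have [[hdp hqp]|nH] := pselect (p = d%:R / 2 /\ q != 2 * p); last by exists 0.
  have [C2 C20 hC2] := scale_sum_critical d0 hdp q0 hqp.
  have [C C0 hC] := @expected_transport_rate R d p q Mq K C2 rho
    (fun lam => 2 `^ (- (lam / 2)) * (lam + 1))
    hd hp hpq hK C20 (fun lam l0 => mulr_ge0 (powR_ge0 _ _) (addr_ge0 l0 ler01)) hC2.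
  have l2 : 0 < ln 2 :> R by rewrite ln_gt0// ltr1n.
  have c0 : 0 <= 2 / ln 2 :> R by rewrite divr_ge0// ltW.
  exists (C * (2 / ln 2 + 1)); first by rewrite mulr_ge0 ?addr_ge0.
  move=> dO Omega P mu X hX hr hM N N0 _; apply: (le_trans (hC _ _ P mu X hX hr hM N N0)).
  rewrite lee_fin -[leRHS]mulrA ler_wpM2l//.
  have -> : 2 `^ (- (ln N%:R / ln 2 / 2)) = N%:R `^ (- (1 / 2)) :> R.
    by rewrite [RHS]powN// mul1r mulrN.
  rewrite [leRHS]mulrDr; apply: lerD.
    rewrite mulrCA ler_wpM2l ?powR_ge0//.
    by apply: (le_trans (log2_le_ln1p R N0)); rewrite ler_wpM2r// lerDl.
  by rewrite ler_peMl ?powR_ge0// lerDr.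
have [C3 C30 h3] : exists2 C : R, 0 <= C &
    bound C (p < d%:R / 2 /\ q != d%:R * p / (d%:R - p)) (fun N => N%:R `^ (- (p / d%:R))).
  have [[hdp hqp]|nH] := pselect (p < d%:R / 2 /\ q != d%:R * p / (d%:R - p)); last by exists 0.
  have [C2' C20' hC2] := scale_sum_low d0 hp hdp q0 hqp.
  have [C C0 hC] := @expected_transport_rate R d p q Mq K C2' rho
    (fun lam => 2 `^ (- (lam * (p / d%:R))))
    hd hp hpq hK C20' (fun lam _ => powR_ge0 _ _) (fun lam n dep _ => hC2 lam n dep).
  exists C => // dO Omega P mu X hX hr hM N N0 _; apply: (le_trans (hC _ _ P mu X hX hr hM N N0)).
  by rewrite [N%:R `^ (- (p / d%:R))]powN// mulrN.
exists (C1 + C2 + C3) => dO Omega P mu X _ hX hr hM N N0 ET n.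
have enlarge (C' a : R) : 0 <= a -> C' <= C1 + C2 + C3 ->
    (ET <= (C' * (a + n `^ (- ((q - p) / q))))%:E)%E ->
    (ET <= ((C1 + C2 + C3) * (a + n `^ (- ((q - p) / q))))%:E)%E.
  move=> a0 hC hET; apply: (le_trans hET); rewrite lee_fin ler_wpM2r//.
  by rewrite addr_ge0// powR_ge0.
split=> c1 c2.
- apply: (enlarge C1); first exact: powR_ge0; first by rewrite -addrA lerDl addr_ge0.
  exact: (h1 _ _ P mu X hX hr hM N N0).
- apply: (enlarge C2); first exact: mulr_ge0 (powR_ge0 _ _) (ln1p0 N).
    by rewrite [C1 + C2]addrC -addrA lerDl addr_ge0.
  exact: (h2 _ _ P mu X hX hr hM N N0).
- apply: (enlarge C3); first exact: powR_ge0; first by rewrite lerDr addr_ge0.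
  exact: (h3 _ _ P mu X hX hr hM N N0).
Qed.
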